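(* Let $\Lambda=(\Lambda_0(t,z),\Lambda_1(t,z),\dots,\Lambda_l(t,z))$ be a $(\Delta,\mathbf e)$-admissible tuple of Laurent polynomials in $\mathbb Z_p[x^{\pm1}]=\mathbb Z_p[t^{\pm1},z^{\pm1}]$. (i) For $0\le s\le l$ we have, modulo $p$, $$A\big(e_1+\dots+e_{s+1},\Delta_0,\Delta_{s+1},\Lambda_0(x)\Lambda_1(x)^{p^{e_1}}\cdots\Lambda_s(x)^{p^{e_1+\dots+e_s}}\big)\equiv A(e_1,\Delta_0,\Delta_1,\Lambda_0(x))\cdot\sigma^{e_1}\big(A(e_2,\Delta_1,\Delta_2,\Lambda_1(x))\big)\cdots\sigma^{e_1+\dots+e_s}\big(A(e_{s+1},\Delta_s,\Delta_{s+1},\Lambda_s(x))\big).$$ (ii) Assume that the determinants of the matrices $A(e_{i+1},\Delta_i,\Delta_{i+1},\Lambda_i(t,z))$, $i=0,1,\dots,l$, are Laurent polynomials all nonzero modulo $p$. Then for $1\le s\le l$ the determinant of the matrix $A\big(e_2+\dots+e_{s+1},\Delta_1,\Delta_{s+1},\Lambda_1(x)\Lambda_2(x)^{p^{e_2}}\cdots\Lambda_s(x)^{p^{e_2+\dots+e_s}}\big)$ is a Laurent polynomial nonzero modulo $p$, and modulo $p^s$ $$A\big(e_1+\dots+e_{s+1},\Delta_0,\Delta_{s+1},\Lambda_0(x)\Lambda_1(x)^{p^{e_1}}\cdots\Lambda_s(x)^{p^{e_1+\dots+e_s}}\big)\cdot\sigma^{e_1}\Big(A\big(e_2+\dots+e_{s+1},\Delta_1,\Delta_{s+1},\Lambda_1(x)\Lambda_2(x)^{p^{e_2}}\cdots\Lambda_s(x)^{p^{e_2+\dots+e_s}}\big)\Big)^{-1}$$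 $$\equiv A\big(e_1+\dots+e_s,\Delta_0,\Delta_s,\Lambda_0(x)\Lambda_1(x)^{p^{e_1}}\cdots\Lambda_{s-1}(x)^{p^{e_1+\dots+e_{s-1}}}\big)\cdot\sigma^{e_1}\Big(A\big(e_2+\dots+e_s,\Delta_1,\Delta_s,\Lambda_1(x)\Lambda_2(x)^{p^{e_2}}\cdots\Lambda_{s-1}(x)^{p^{e_2+\dots+e_{s-1}}}\big)\Big)^{-1},$$ where for $s=1$ the second factor on the right-hand side is understood as the $g\times g$ identity matrix.
   Context: Let $p$ be an odd prime, $t=(t_1,\dots,t_r)$ and $z=(z_1,\dots,z_n)$ two groups of variables, $x=(t,z)$. Congruence modulo $p^s$ of Laurent polynomials over $\mathbb Z_p$ means divisibility by $p^s$ of all coefficients of the difference; for matrices it is entrywise. For a Laurent polynomial $G(w)$ put $\sigma(G)(w)=G(w^p)$ (each variable is raised to the $p$-th power; coefficients are unchanged); $\sigma$ is applied to matrices entrywise. Let $l\ge0$, let $\mathbf e=(e_1,\dots,e_{l+1})$ be positive integers and $\Delta=(\Delta_0,\dots,\Delta_{l+1})$ a tuple of nonempty finite subsets of $\mathbb Z^r$, all of the same size $g$ (each with a fixed ordering). For a Laurent polynomial $F(t,z)$ let $N(F)\subset\mathbb R^r$ be its Newton polytope with respect to the $t$ variables only. The tuple $\Lambda$ is $(\Delta,\mathbf e)$-admissible if, with $N_i=N(\Lambda_i)$, for all $0\le i\le j<l$ $$\big(\Delta_i+N_i+p^{e_{i+1}}N_{i+1}+\dots+p^{e_{i+1}+\dots+e_j}N_j\big)\cap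 p^{e_{i+1}+\dots+e_{j+1}}\mathbb Z^r\subset p^{e_{i+1}+\dots+e_{j+1}}\Delta_{j+1}.$$ Hasse–Witt matrix: for $m\ge1$ and finite $\Delta',\Delta''\subset\mathbb Z^r$, $A(m,\Delta',\Delta'',F(t,z))$ is the matrix with rows indexed by $u\in\Delta'$, columns by $v\in\Delta''$, and $(u,v)$ entry the coefficient of $t^{p^mv-u}$ in $F(t,z)$ (a Laurent polynomial in $z$). A congruence $F_1F_2^{-1}\equiv G_1G_2^{-1}\pmod{p^s}$ of $g\times g$ matrices with Laurent polynomial entries, where $\det F_2,\det G_2$ are nonzero modulo $p$, is understood as follows: by Cramer's rule write $F_1F_2^{-1}=\frac1{\det F_2}F$ and $G_1G_2^{-1}=\frac1{\det G_2}G$ with $F,G$ Laurent polynomial matrices; the congruence means $F\cdot\det G_2\equiv G\cdot\det F_2\pmod{p^s}$. *)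

(* Defs.v *)
From HB Require Import structures.
From mathcomp Require Import all_boot all_order all_algebra finmap.
From mathcomp Require Import multinomials.monalg.
From mathcomp Require Import boolp classical_sets reals convex.

Set Implicit Arguments.
Unset Strict Implicit.
Unset Printing Implicit Defensive.

Import Order.TTheory GRing.Theory Num.Theory.

Local Open Scope ring_scope.

(* Z_p as the inverse limit of the rings Z/p^(k+1), k >= 0. The primality
   proof is a parameter so that 1 != 0 and the moduli exceed 1, as required by
   'Z_m. *)

Record padic_int (p : nat) (p_pr : prime p) : Type := PadicInt {
  padic_res : forall k : nat, 'Z_(p ^ k.+1);
  padic_resP : forall k : nat,
    (padic_res k.+1 : nat)%:R = padic_res k :> 'Z_(p ^ k.+1) }.

Section PadicRing.
Variables (p : nat) (p_pr : prime p).
Local Notation Zp := (padic_int p_pr).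

HB.instance Definition _ := gen_eqMixin Zp.
HB.instance Definition _ := gen_choiceMixin Zp.

Lemma padic_inj (x y : Zp) : (forall k, padic_res x k = padic_res y k) -> x = y.
Proof.
case: x y => [x xP] [y yP] /= exy.
have e : x = y by apply: functional_extensionality_dep.
by subst y; rewrite (Prop_irrelevance xP yP).
Qed.

Fact padic_modulus_gt1 k : (1 < p ^ k.+1)%N.
Proof. by rewrite -{1}(expn0 p) ltn_exp2l // prime_gt1. Qed.

(* reduction modulo p^(k+1) on representatives modulo p^(k+2) *)
Fact padic_redE k (x : nat) :
  ((x %% p ^ k.+2)%N)%:R = x%:R :> 'Z_(p ^ k.+1).
Proof.
rewrite -[LHS]Zp_nat_mod ?padic_modulus_gt1 //.
rewrite -[RHS]Zp_nat_mod ?padic_modulus_gt1 //.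
by rewrite modn_dvdm // dvdn_exp2l.
Qed.

Fact padic_val_nat k (x : nat) :
  (x%:R : 'Z_(p ^ k.+1)) = (x %% p ^ k.+1)%N :> nat.
Proof. by rewrite val_Zp_nat // padic_modulus_gt1. Qed.

Fact padic_zero_subproof k :
  ((0%R : 'Z_(p ^ k.+2)) : nat)%:R = 0 :> 'Z_(p ^ k.+1).
Proof. by []. Qed.

Fact padic_one_subproof k :
  ((1%R : 'Z_(p ^ k.+2)) : nat)%:R = 1 :> 'Z_(p ^ k.+1).
Proof. by []. Qed.

Fact padic_add_subproof (x y : Zp) k :
  (((padic_res x k.+1 + padic_res y k.+1)%R : 'Z_(p ^ k.+2)) : nat)%:R
    = padic_res x k + padic_res y k.
Proof.
rewrite -(padic_resP x k) -(padic_resP y k) -natrD -[RHS]padic_redE.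
rewrite -padic_val_nat natrD !natr_Zp //.
Qed.

Fact padic_mul_subproof (x y : Zp) k :
  (((padic_res x k.+1 * padic_res y k.+1)%R : 'Z_(p ^ k.+2)) : nat)%:R
    = padic_res x k * padic_res y k.
Proof.
rewrite -(padic_resP x k) -(padic_resP y k) -natrM -[RHS]padic_redE.
rewrite -padic_val_nat natrM !natr_Zp //.
Qed.

Fact padic_opp_subproof (x : Zp) k :
  (((- padic_res x k.+1)%R : 'Z_(p ^ k.+2)) : nat)%:R = - padic_res x k.
Proof.
apply/eqP; rewrite -subr_eq0 opprK -(padic_resP x k) -natrD -padic_redE.
by rewrite -padic_val_nat natrD !natr_Zp addNr.
Qed.

Definition padic_zero : Zp := PadicInt p_pr padic_zero_subproof.
Definition padic_one : Zp := PadicInt p_pr padic_one_subproof.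
Definition padic_add (x y : Zp) : Zp := PadicInt p_pr (padic_add_subproof x y).
Definition padic_mul (x y : Zp) : Zp := PadicInt p_pr (padic_mul_subproof x y).
Definition padic_opp (x : Zp) : Zp := PadicInt p_pr (padic_opp_subproof x).

Fact padic_addA : associative padic_add.
Proof. by move=> x y z; apply: padic_inj => k /=; rewrite addrA. Qed.
Fact padic_addC : commutative padic_add.
Proof. by move=> x y; apply: padic_inj => k /=; rewrite addrC. Qed.
Fact padic_add0 : left_id padic_zero padic_add.
Proof. by move=> x; apply: padic_inj => k /=; rewrite add0r. Qed.
Fact padic_addN : left_inverse padic_zero padic_opp padic_add.
Proof. by move=> x; apply: padic_inj => k /=; rewrite addNr. Qed.

HB.instance Definition _ :=
  GRing.isZmodule.Build Zp padic_addA padic_addC padic_add0 padic_addN.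

Fact padic_mulA : associative padic_mul.
Proof. by move=> x y z; apply: padic_inj => k /=; rewrite mulrA. Qed.
Fact padic_mulC : commutative padic_mul.
Proof. by move=> x y; apply: padic_inj => k /=; rewrite mulrC. Qed.
Fact padic_mul1 : left_id padic_one padic_mul.
Proof. by move=> x; apply: padic_inj => k /=; rewrite mul1r. Qed.
Fact padic_mulDl : left_distributive padic_mul +%R.
Proof. by move=> x y z; apply: padic_inj => k /=; rewrite mulrDl. Qed.
Fact padic_one_neq0 : padic_one != 0.
Proof.
apply/eqP => /(congr1 (fun x : Zp => padic_res x 0)) /= /eqP.
by rewrite oner_eq0.
Qed.

HB.instance Definition _ := GRing.Zmodule_isComNzRing.Build Zp
  padic_mulA padic_mulC padic_mul1 padic_mulDl padic_one_neq0.

End PadicRing.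

(* R[w_1^{+-1}, ..., w_k^{+-1}] : finitely supported functions on Z^k with the
   convolution product. The ring structure of monalg is not available here, as
   it requires a monoid of exponents without nontrivial units. *)

Definition laurent (k : nat) (R : nzRingType) : Type := {malg R['rV[int]_k]}.

Section LaurentRing.
Variables (k : nat) (R : comNzRingType).
Local Notation L := (laurent k R).
Implicit Types f g h : L.

HB.instance Definition _ := GRing.Zmodule.on L.

Definition laurent_one : L := << 1 *g (0 : 'rV[int]_k)%R >>.
Definition laurent_mul f g : L :=
  \sum_(a <- msupp f) \sum_(b <- msupp g) << f@_a * g@_b *g (a + b)%R >>.

Fact laurent_mulw (A B : {fset 'rV[int]_k}) f g :
  (msupp f `<=` A)%fset -> (msupp g `<=` B)%fset ->
  laurent_mul f g =
    \sum_(a <- A) \sum_(b <- B) << f@_a * g@_b *g (a + b)%R >> :> {malg R['rV[int]_k]}.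
Proof.
move=> fA gB; rewrite /laurent_mul (big_fset_incl _ fA) /=.
  apply/eq_bigr=> a _; apply/big_fset_incl => // b _ /mcoeff_outdom ->.
  by rewrite mulr0 monalgU0.
move=> a _ /mcoeff_outdom fa.
by rewrite big1 => // b _; rewrite fa mul0r monalgU0.
Qed.

Fact laurent_mulC : commutative laurent_mul.
Proof.
move=> f g; rewrite /laurent_mul exchange_big; apply: eq_bigr => a _.
by apply: eq_bigr => b _; rewrite mulrC addrC.
Qed.

Fact laurent_mulDl : left_distributive laurent_mul +%R.
Proof.
move=> f g h.
have fs := fsubset_refl (msupp h).
rewrite (laurent_mulw (msuppD_le f g) fs).
rewrite (laurent_mulw (fsubsetUl _ (msupp g)) fs).
rewrite (laurent_mulw (fsubsetUr (msupp f) _) fs).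
rewrite -big_split /=; apply/eq_bigr=> a _.
rewrite -big_split /=; apply/eq_bigr=> b _.
by rewrite mcoeffD mulrDl monalgUD.
Qed.

Fact laurent_mulDr : right_distributive laurent_mul +%R.
Proof. by move=> f g h; rewrite !(laurent_mulC f) laurent_mulDl. Qed.

Fact laurent_mul0 : left_zero 0 laurent_mul.
Proof. by move=> f; rewrite /laurent_mul msupp0 big_seq_fset0. Qed.

Fact laurent_mulr0 : right_zero 0 laurent_mul.
Proof. by move=> f; rewrite laurent_mulC laurent_mul0. Qed.

Fact laurent_mulUU (c d : R) (a b : 'rV[int]_k) :
  laurent_mul << c *g a >> << d *g b >> = << c * d *g (a + b)%R >>.
Proof.
by rewrite (laurent_mulw msuppU_le msuppU_le) !big_seq_fset1 !mcoeffUU.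
Qed.

Fact laurent_mulA : associative laurent_mul.
Proof.
move=> f g h.
have suml I (s : seq I) (F : I -> L) (x : L) :
    laurent_mul (\sum_(i <- s) F i) x = \sum_(i <- s) laurent_mul (F i) x.
  exact: (big_morph (laurent_mul^~ x) (fun _ _ => laurent_mulDl _ _ _)
            (laurent_mul0 x)).
have sumr I (s : seq I) (F : I -> L) (x : L) :
    laurent_mul x (\sum_(i <- s) F i) = \sum_(i <- s) laurent_mul x (F i).
  exact: (big_morph (laurent_mul x) (fun _ _ => laurent_mulDr _ _ _)
            (laurent_mulr0 x)).
have := laurent_mulUU; move: laurent_mul suml sumr => M suml sumr mulUU.
rewrite [f]monalgE [g]monalgE [h]monalgE.
rewrite !suml; apply: eq_bigr => a _.
rewrite [LHS]sumr [M _ (\sum_(b <- msupp g) _)]sumr suml.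
apply: eq_bigr => b _.
rewrite !sumr; apply: eq_bigr => c _.
by rewrite !mulUU mulrA addrA.
Qed.

Fact laurent_mul1 : left_id laurent_one laurent_mul.
Proof.
move=> f; rewrite (laurent_mulw msuppU_le (fsubset_refl _)) big_seq_fset1.
rewrite [RHS]monalgE; apply: eq_bigr => a _.
by rewrite mcoeffUU mul1r add0r.
Qed.

Fact laurent_one_neq0 : laurent_one != 0.
Proof.
by apply/eqP/malgP=> /(_ 0%R) /eqP; rewrite mcoeffUU mcoeff0 oner_eq0.
Qed.

HB.instance Definition _ := GRing.Zmodule_isComNzRing.Build L
  laurent_mulA laurent_mulC laurent_mul1 laurent_mulDl laurent_one_neq0.

End LaurentRing.

Section Congruences.
Variables (p : nat) (p_pr : prime p) (n : nat).
Local Notation Lz := (laurent n (padic_int p_pr)).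

(* F = G modulo p^s, coefficientwise in Z_p *)
Definition lcong (s : nat) (F G : Lz) : Prop :=
  forall a : 'rV[int]_n,
    exists c : padic_int p_pr, (F - G)@_a = (p ^ s)%:R * c.

Definition mxcong (s m1 m2 : nat) (F G : 'M[Lz]_(m1, m2)) : Prop :=
  forall i j, lcong s (F i j) (G i j).

(* F1 F2^-1 = G1 G2^-1 modulo p^s. By Cramer's rule
   F1 F2^-1 = (det F2)^-1 (F1 adj F2), and likewise for G1 G2^-1. The
   nonvanishing of both determinants modulo p is part of the assertion. *)
Definition fraccong (s g : nat) (F1 F2 G1 G2 : 'M[Lz]_g) : Prop :=
  [/\ ~ lcong 1 (\det F2) 0, ~ lcong 1 (\det G2) 0
    & mxcong s (\det G2 *: (F1 *m \adj F2)) (\det F2 *: (G1 *m \adj G2))].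

(* G(w) |-> G(w^p); the exponent vectors are written additively *)
Definition sigma (G : Lz) : Lz :=
  \sum_(a <- msupp G) << G@_a *g (a *+ p)%R >>.

Definition sigma_mx (e m1 m2 : nat) (F : 'M[Lz]_(m1, m2)) : 'M[Lz]_(m1, m2) :=
  map_mx (iter e sigma) F.

End Congruences.

(* Z_p[t^{+-1}, z^{+-1}] is taken as Z_p[z^{+-1}][t^{+-1}], so that the
   coefficient of t^u in F is F@_u, a Laurent polynomial in z. *)
Definition laurent_tz (p : nat) (p_pr : prime p) (r n : nat) : Type :=
  laurent r (laurent n (padic_int p_pr)).

Section HasseWitt.
Variables (p : nat) (p_pr : prime p) (r n : nat).
Local Notation Lz := (laurent n (padic_int p_pr)).
Local Notation Ltz := (laurent_tz p_pr r n).

Definition HasseWitt (m g1 g2 : nat) (D1 : g1.-tuple 'rV[int]_r)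
    (D2 : g2.-tuple 'rV[int]_r) (F : Ltz) : 'M[Lz]_(g1, g2) :=
  \matrix_(i, j) F@_(tnth D2 j *+ (p ^ m) - tnth D1 i)%R.

(* e_{i+1} + ... + e_k *)
Definition epart (e : nat -> nat) (i k : nat) : nat :=
  (\sum_(i.+1 <= h < k.+1) e h)%N.

(* A(e_{i+1} + ... + e_{s+1}, Delta_i, Delta_{s+1},
     Lambda_i Lambda_{i+1}^{p^e_{i+1}} ... Lambda_s^{p^{e_{i+1} + ... + e_s}}) *)
Definition HasseWitt_tuple (g : nat) (e : nat -> nat)
    (Delta : nat -> g.-tuple 'rV[int]_r) (Lambda : nat -> Ltz)
    (i s : nat) : 'M[Lz]_g :=
  HasseWitt (epart e i s.+1) (Delta i) (Delta s.+1)
    (\prod_(i <= k < s.+1) Lambda k ^+ (p ^ epart e i k)).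

End HasseWitt.

Section Admissible.
Local Open Scope classical_set_scope.
Variables (R : realType) (r : nat).
Implicit Types A B : set 'rV[R]_r.

Definition minkowski A B : set 'rV[R]_r := [set a + b | a in A & b in B].
Definition dilate (c : nat) A : set 'rV[R]_r := [set c%:R *: a | a in A].

Definition real_points (S : set 'rV[int]_r) : set 'rV[R]_r :=
  [set map_mx intr u | u in S].

Definition convex_hull A : set 'rV[R]_r := smallest (@convex_set R 'rV[R]_r) A.

(* Newton polytope with respect to t only *)
Definition newton (p : nat) (p_pr : prime p) (n : nat)
    (F : laurent_tz p_pr r n) : set 'rV[R]_r :=
  convex_hull (real_points [set u | F@_u != 0]).

Definition admissible (p : nat) (p_pr : prime p) (n g l : nat)
    (e : nat -> nat) (Delta : nat -> g.-tuple 'rV[int]_r)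
    (Lambda : nat -> laurent_tz p_pr r n) : Prop :=
  forall i j : nat, (i <= j < l)%N ->
    minkowski (real_points [set` Delta i])
      (\big[minkowski/[set 0]]_(i <= k < j.+1)
          dilate (p ^ epart e i k) (newton (Lambda k)))
      `&` dilate (p ^ epart e i j.+1) (real_points setT)
    `<=` dilate (p ^ epart e i j.+1) (real_points [set` Delta j.+1]).

End Admissible.

(* Main.v *)
Require Import Defs.
From HB Require Import structures.
From mathcomp Require Import all_boot all_order all_algebra finmap.
From mathcomp Require Import multinomials.monalg.
From mathcomp Require Import boolp classical_sets reals convex.
From mathcomp Require Import perm interval_inference zify.

Set Implicit Arguments.
Unset Strict Implicit.
Unset Printing Implicit Defensive.

Import Order.TTheory GRing.Theory Num.Theory.

Local Open Scope ring_scope.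

(** Write P_(i,s) for the product of the Lambda_k ^ (p ^ (e_(i+1) + ... + e_k)),
    i <= k <= s, and A_(i,s) for its Hasse-Witt matrix. Since raising to the power
    p lifts to a ring endomorphism sigma modulo p, one can split
      P_(i,s) = sum_(i <= j <= s) V_(i,j) sigma^(...)(P_(j+1,s))
    with "ghosts" V_(i,j) that vanish modulo p^(j-i) and are supported in the same
    Minkowski sum as P_(i,j). Admissibility makes the Hasse-Witt matrix of each
    summand a product, so A_(i,s) = sum_j B_(i,j) sigma^(...)(A_(j+1,s)) with
    B_(i,j) = 0 modulo p^(j-i). Modulo p only j = i survives, which is (i).
    For (ii), the matrices A_(k,s-1)^-1 A_(k,s) and sigma(A_(k+1,s-1)^-1 A_(k+1,s))
    agree modulo p^(s-k) by descending induction on k: multiplying the two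
    expansions of A_(i,s) and A_(i,s-1) on the right by the inverses of
    sigma(A_(i+1,s)) and sigma(A_(i+1,s-1)), the j-th terms differ by B_(i,j) times
    a matrix which vanishes modulo p^(s-j). Denominators are cleared throughout,
    and cancelled because p is a prime element of the ring of Laurent polynomials. *)

(** * Congruences modulo powers of p *)

Definition pdvd (R : comNzRingType) (p s : nat) (x : R) : Prop :=
  exists y, x = y *+ p ^ s.

Section Pdvd.
Variables (R : comNzRingType) (p : nat).
Implicit Types (x y : R) (s t : nat).

Lemma pdvd0 s : pdvd p s (0 : R).
Proof. by exists 0; rewrite mul0rn. Qed.

Lemma pdvd_exp0 x : pdvd p 0 x.
Proof. by exists x; rewrite expn0. Qed.

Lemma pdvdD s x y : pdvd p s x -> pdvd p s y -> pdvd p s (x + y).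
Proof. by move=> [a ->] [b ->]; exists (a + b); rewrite mulrnDl. Qed.

Lemma pdvdN s x : pdvd p s x -> pdvd p s (- x).
Proof. by move=> [a ->]; exists (- a); rewrite mulNrn. Qed.

Lemma pdvdB s x y : pdvd p s x -> pdvd p s y -> pdvd p s (x - y).
Proof. by move=> hx hy; apply: pdvdD => //; apply: pdvdN. Qed.

Lemma pdvd_mull s x y : pdvd p s y -> pdvd p s (x * y).
Proof. by move=> [a ->]; exists (x * a); rewrite mulrnAr. Qed.

Lemma pdvd_mulr s x y : pdvd p s x -> pdvd p s (x * y).
Proof. by rewrite mulrC; apply: pdvd_mull. Qed.

Lemma pdvdM s t x y : pdvd p s x -> pdvd p t y -> pdvd p (s + t) (x * y).
Proof.
by move=> [a ->] [b ->]; exists (a * b); rewrite mulrnAl mulrnAr -mulrnA expnD mulnC.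
Qed.

Lemma pdvdW s t x : (s <= t)%N -> pdvd p t x -> pdvd p s x.
Proof.
move=> le_st [a ->]; exists (a *+ p ^ (t - s)).
by rewrite -mulrnA -expnD subnK.
Qed.

Lemma pdvd_sum s (I : eqType) (r : seq I) (P : pred I) (F : I -> R) :
  (forall i, i \in r -> P i -> pdvd p s (F i)) ->
  pdvd p s (\sum_(i <- r | P i) F i).
Proof.
move=> dF; rewrite big_seq_cond.
apply: (big_ind (pdvd p s)) => [|x y|i /andP[]]; [exact: pdvd0|exact: pdvdD|exact: dF].
Qed.

Lemma pdvd_trans s x y z : pdvd p s (x - y) -> pdvd p s (y - z) -> pdvd p s (x - z).
Proof. by move=> hxy hyz; rewrite -(subrKA y); apply: pdvdD. Qed.

Lemma pdvd_subC s x y : pdvd p s (x - y) -> pdvd p s (y - x).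
Proof. by move=> h; rewrite -opprB; apply: pdvdN. Qed.

Lemma pdvd_mulB s x1 y1 x2 y2 :
  pdvd p s (x1 - y1) -> pdvd p s (x2 - y2) -> pdvd p s (x1 * x2 - y1 * y2).
Proof.
move=> h1 h2; apply: (@pdvd_trans _ _ (x1 * y2)).
  by rewrite -mulrBr; apply: pdvd_mull.
by rewrite -mulrBl; apply: pdvd_mulr.
Qed.

Lemma pdvd_expB1 s x y m : pdvd p s (x - y) -> pdvd p s (x ^+ m - y ^+ m).
Proof.
by move=> h; elim: m => [|m IHm]; rewrite ?subrr ?exprS; [exact: pdvd0|exact: pdvd_mulB].
Qed.

Lemma pdvd_expB k x y :
  pdvd p 1 (x - y) -> pdvd p k.+1 (x ^+ (p ^ k) - y ^+ (p ^ k)).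
Proof.
move=> h; elim: k => [|k IHk]; first by rewrite expn0 !expr1.
rewrite expnSr !exprM; set X := x ^+ _; set Y := y ^+ _; rewrite subrXX -addn1.
apply: pdvdM => //.
have dXY : pdvd p 1 (X - Y) by apply: pdvd_expB1.
rewrite -[X in pdvd p 1 X](subrK (Y ^+ p.-1 *+ p)); apply: pdvdD; last first.
  by exists (Y ^+ p.-1); rewrite expn1.
have -> : Y ^+ p.-1 *+ p = \sum_(i < p) Y ^+ p.-1 by rewrite sumr_const card_ord.
rewrite -sumrB; apply: pdvd_sum => i _ _.
have -> : Y ^+ p.-1 = Y ^+ (p.-1 - i) * Y ^+ i.
  rewrite -exprD; congr (_ ^+ _).
  by have := ltn_ord i; lia.
by rewrite -mulrBl; apply: pdvd_mulr; apply: pdvd_expB1.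
Qed.

End Pdvd.

Lemma pdvd_exp_add (R : comNzRingType) p (x y : R) :
  prime p -> pdvd p 1 ((x + y) ^+ p - (x ^+ p + y ^+ p)).
Proof.
move=> p_pr; case: p p_pr => // q q_pr.
rewrite exprDn big_ord_recl big_ord_recr /= !subn0 subnn !bin0 binn.
rewrite !expr0 mulr1 mul1r !mulr1n.
have cancel (a b c : R) : a + (b + c) - (a + c) = b by rewrite addrCA addrK.
rewrite cancel.
apply: pdvd_sum => i _ _.
have /dvdnP[m ->] : (q.+1 %| 'C(q.+1, bump 0 i))%N.
  by apply: prime_dvd_bin => //; rewrite /bump /= add1n ltnS /=.
by exists ((x ^+ (q.+1 - bump 0 i) * y ^+ bump 0 i) *+ m); rewrite -mulrnA expn1.
Qed.

Lemma pdvd_exp_sum (R : comNzRingType) p (I : eqType) (r : seq I) (F : I -> R) : prime p ->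
  pdvd p 1 ((\sum_(i <- r) F i) ^+ p - \sum_(i <- r) F i ^+ p).
Proof.
move=> p_pr; elim: r => [|i r IHr].
  by rewrite !big_nil expr0n gtn_eqF ?prime_gt0 // subrr; apply: pdvd0.
rewrite !big_cons; apply: pdvd_trans (pdvd_exp_add _ _ p_pr) _.
by rewrite opprD addrACA subrr add0r.
Qed.

Lemma pdvd_raddf (R S : comNzRingType) (f : {additive R -> S}) p s x :
  pdvd p s x -> pdvd p s (f x).
Proof. by move=> [y ->]; exists (f y); rewrite raddfMn. Qed.

Definition prime_elt (R : comNzRingType) (p : nat) : Prop :=
  (forall x : R, x *+ p = 0 -> x = 0) /\
  (forall x y : R, pdvd p 1 (x * y) -> pdvd p 1 x \/ pdvd p 1 y).

Definition mdvd (R : comNzRingType) (p s m n : nat) (A : 'M[R]_(m, n)) : Prop :=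
  forall i j, pdvd p s (A i j).

Section PrimeElt.
Variables (R : comNzRingType) (p : nat).
Hypothesis p_prime : prime_elt R p.

Lemma pdvd_cancel s (d x : R) : ~ pdvd p 1 d -> pdvd p s (d * x) -> pdvd p s x.
Proof.
case: p_prime => p_reg p_div nd.
elim: s x => [|s IHs] x; first by move=> _; apply: pdvd_exp0.
move=> dx; have [//|[y xE]] : pdvd p 1 d \/ pdvd p 1 x.
  by apply: p_div; apply: pdvdW dx.
rewrite {}xE expn1 in dx *.
suff [z ->] : pdvd p s y by exists z; rewrite -mulrnA expnSr.
apply: IHs; case: dx => z /eqP; rewrite expnSr mulrnA mulrnAr -subr_eq0 -mulrnBl.
by move=> /eqP/p_reg/eqP; rewrite subr_eq0 => /eqP ->; exists z.
Qed.

Lemma npdvdM (x y : R) : ~ pdvd p 1 x -> ~ pdvd p 1 y -> ~ pdvd p 1 (x * y).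
Proof. by move=> nx ny /(proj2 p_prime)[]. Qed.

Lemma mdvd_cancel s m n (d : R) (A : 'M[R]_(m, n)) :
  ~ pdvd p 1 d -> mdvd p s (d *: A) -> mdvd p s A.
Proof. by move=> nd dA i j; apply: (pdvd_cancel nd); have:= dA i j; rewrite mxE. Qed.

End PrimeElt.

Section Mdvd.
Variables (R : comNzRingType) (p : nat).
Implicit Types s m n : nat.

Lemma mdvd0 s m n : mdvd p s (0 : 'M[R]_(m, n)).
Proof. by move=> i j; rewrite mxE; apply: pdvd0. Qed.

Lemma mdvdD s m n (A B : 'M[R]_(m, n)) : mdvd p s A -> mdvd p s B -> mdvd p s (A + B).
Proof. by move=> dA dB i j; rewrite mxE; apply: pdvdD. Qed.

Lemma mdvdN s m n (A : 'M[R]_(m, n)) : mdvd p s A -> mdvd p s (- A).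
Proof. by move=> dA i j; rewrite mxE; apply: pdvdN. Qed.

Lemma mdvdZ s m n (c : R) (A : 'M[R]_(m, n)) : mdvd p s A -> mdvd p s (c *: A).
Proof. by move=> dA i j; rewrite mxE; apply: pdvd_mull. Qed.

Lemma mdvdM s t m n k (A : 'M[R]_(m, n)) (B : 'M[R]_(n, k)) :
  mdvd p s A -> mdvd p t B -> mdvd p (s + t) (A *m B).
Proof. by move=> dA dB i j; rewrite mxE; apply: pdvd_sum => h _ _; apply: pdvdM. Qed.

Lemma mdvd_mull s m n k (A : 'M[R]_(m, n)) (B : 'M[R]_(n, k)) :
  mdvd p s B -> mdvd p s (A *m B).
Proof. by apply: (@mdvdM 0) => i j; apply: pdvd_exp0. Qed.

Lemma mdvd_mulr s m n k (A : 'M[R]_(m, n)) (B : 'M[R]_(n, k)) :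
  mdvd p s A -> mdvd p s (A *m B).
Proof. by move=> dA; rewrite -(addn0 s); apply: mdvdM => // i j; apply: pdvd_exp0. Qed.

Lemma mdvdW s t m n (A : 'M[R]_(m, n)) : (s <= t)%N -> mdvd p t A -> mdvd p s A.
Proof. by move=> st dA i j; apply: pdvdW (dA i j). Qed.

Lemma mdvd_sum s m n (I : eqType) (r : seq I) (F : I -> 'M[R]_(m, n)) :
  (forall i, i \in r -> mdvd p s (F i)) -> mdvd p s (\sum_(i <- r) F i).
Proof.
move=> dF; rewrite big_seq.
by apply: big_ind; [exact: mdvd0|exact: mdvdD|].
Qed.

Lemma mdvd_trans s m n (A B C : 'M[R]_(m, n)) :
  mdvd p s (A - B) -> mdvd p s (B - C) -> mdvd p s (A - C).
Proof. by move=> hAB hBC; rewrite -(subrKA B); apply: mdvdD. Qed.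

Lemma mdvd_det s n (A B : 'M[R]_n) : mdvd p s (A - B) -> pdvd p s (\det A - \det B).
Proof.
move=> dAB; rewrite /determinant -sumrB; apply: pdvd_sum => w _ _.
rewrite -mulrBr; apply: pdvd_mull.
elim/big_rec2: _ => [|i x y _ dxy]; first by rewrite subrr; apply: pdvd0.
by apply: pdvd_mulB => //; have:= dAB i (w i); rewrite !mxE.
Qed.

Lemma mdvd_sum_mulB n i s (c d : R) (B X Y : nat -> 'M[R]_n) (C X' Y' : 'M[R]_n) :
    (forall j, (i <= j <= s)%N -> mdvd p (j - i) (B j)) ->
    (forall j, (i <= j <= s)%N ->
       mdvd p (s.+1 - j) (c *: (X j *m X') - d *: (Y j *m Y'))) ->
    mdvd p (s.+1 - i) C ->
  mdvd p (s.+1 - i) (c *: ((\sum_(i <= j < s.+1) B j *m X j + C) *m X') -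
                     d *: ((\sum_(i <= j < s.+1) B j *m Y j) *m Y')).
Proof.
move=> dB dXY dC; rewrite mulmxDl scalerDr addrAC; apply: mdvdD; last first.
  by apply: mdvdZ; apply: mdvd_mulr.
rewrite !mulmx_suml !scaler_sumr -sumrB; apply: mdvd_sum => j.
rewrite mem_index_iota => ijs.
rewrite -!mulmxA (scalemxAr c) (scalemxAr d) -mulmxBr.
have -> : (s.+1 - i = (j - i) + (s.+1 - j))%N by lia.
by apply: mdvdM; [exact: dB|exact: dXY].
Qed.

End Mdvd.

(** * Congruences between matrix fractions *)

Section FractionCongruence.
Variables (R : comNzRingType) (p : nat).
Hypothesis p_prime : prime_elt R p.
Variable n : nat.
Implicit Types X Y : 'M[R]_n.

(* [Y^-1 X = Y'^-1 X'] modulo p^s, with denominators cleared *)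
Definition quo_cong s X Y X' Y' : Prop :=
  mdvd p s (\det Y' *: (\adj Y *m X) - \det Y *: (\adj Y' *m X')).

Lemma quo_cong_of_fraccong s X Y X' Y' : ~ pdvd p 1 (\det X') ->
  mdvd p s (\det Y' *: (X *m \adj X') - \det X' *: (Y *m \adj Y')) ->
  quo_cong s X Y X' Y'.
Proof.
move=> nX' h; apply: (mdvd_cancel p_prime nX').
have := mdvd_mulr X' (mdvd_mull (\adj Y) h).
congr mdvd; rewrite mulmxBr mulmxBl -!scalemxAr -!scalemxAl scalerBr.
have -> : \adj Y *m (X *m \adj X') *m X' = \det X' *: (\adj Y *m X).
  by rewrite -!mulmxA mul_adj_mx mul_mx_scalar -scalemxAr.
have -> : \adj Y *m (Y *m \adj Y') *m X' = \det Y *: (\adj Y' *m X').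
  by rewrite mulmxA mul_adj_mx mul_scalar_mx scalemxAl.
by congr (_ - _); rewrite !scalerA mulrC.
Qed.

Lemma fraccong_of_quo_cong s X Y X' Y' : ~ pdvd p 1 (\det Y) ->
  quo_cong s X Y X' Y' ->
  mdvd p s (\det Y' *: (X *m \adj X') - \det X' *: (Y *m \adj Y')).
Proof.
move=> nY h; apply: (mdvd_cancel p_prime nY).
have := mdvd_mulr (\adj X') (mdvd_mull Y h).
congr mdvd; rewrite mulmxBr mulmxBl -!scalemxAr -!scalemxAl scalerBr.
have -> : Y *m (\adj Y *m X) *m \adj X' = \det Y *: (X *m \adj X').
  by rewrite mulmxA mul_mx_adj mul_scalar_mx scalemxAl.
have -> : Y *m (\adj Y' *m X') *m \adj X' = \det X' *: (Y *m \adj Y').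
  by rewrite -!mulmxA mul_mx_adj mul_mx_scalar -scalemxAr.
by congr (_ - _); rewrite !scalerA mulrC.
Qed.

Lemma quo_cong_refl s X Y : quo_cong s X Y X Y.
Proof. by rewrite /quo_cong subrr; apply: mdvd0. Qed.

Lemma quo_cong_sym s X Y X' Y' : quo_cong s X Y X' Y' -> quo_cong s X' Y' X Y.
Proof. by move=> /mdvdN; rewrite opprB. Qed.

Lemma quo_cong_trans s X Y X' Y' X'' Y'' : ~ pdvd p 1 (\det Y') ->
  quo_cong s X Y X' Y' -> quo_cong s X' Y' X'' Y'' -> quo_cong s X Y X'' Y''.
Proof.
move=> nY' h1 h2; apply: (mdvd_cancel p_prime nY').
rewrite scalerBr.
apply: (mdvd_trans (B := \det Y'' *: (\det Y *: (\adj Y' *m X')))).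
  have := mdvdZ (\det Y'') h1; congr mdvd.
  by rewrite scalerBr !scalerA (mulrC (\det Y'')).
have := mdvdZ (\det Y) h2; congr mdvd.
by rewrite scalerBr !scalerA; congr (_ *: _ - _ *: _); rewrite mulrC.
Qed.

End FractionCongruence.

(** * p-adic integers *)

Section PadicDivisibility.
Variables (p : nat) (p_pr : prime p).
Local Notation Zp := (padic_int p_pr).
Implicit Types x y : Zp.

Lemma padic_res_natP k (a b : nat) :
  (a%:R = b%:R :> 'Z_(p ^ k.+1)) <-> a = b %[mod p ^ k.+1].
Proof.
split=> [/(congr1 (fun z : 'Z_(p ^ k.+1) => z : nat))|eab].
  by rewrite !(padic_val_nat p_pr).
by apply: val_inj; rewrite /= !(padic_val_nat p_pr).
Qed.

Lemma padic_res0_natP (a b : nat) :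
  (a%:R = b%:R :> 'Z_(p ^ 1)) <-> a = b %[mod p].
Proof.
split=> [/(padic_res_natP 0)|eab]; first by rewrite expn1.
by apply/(padic_res_natP 0); rewrite expn1.
Qed.

Lemma padic_resMn x n k : padic_res (x *+ n) k = padic_res x k *+ n.
Proof. by elim: n => // n IHn; rewrite !mulrS -IHn. Qed.

Lemma padic_resX x n k : padic_res (x ^+ n) k = padic_res x k ^+ n.
Proof. by elim: n => // n IHn; rewrite !exprS -IHn. Qed.

Lemma padic_res_cong x k :
  (padic_res x k.+1 : nat) = (padic_res x k : nat) %[mod p ^ k.+1].
Proof. by apply/(padic_res_natP k); rewrite padic_resP natr_Zp. Qed.

Lemma padic_reg x : x *+ p = 0 -> x = 0.
Proof.
move=> xp0; apply: padic_inj => k /=.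
have := padic_resMn x p k.+1; rewrite xp0 /= => /esym.
rewrite -{1}[padic_res x k.+1]natr_Zp -(padic_resP x k).
move: (nat_of_ord (padic_res x k.+1)) => a.
rewrite -mulrnA -(mulr0n 1) => /(padic_res_natP k.+1 _ 0).
rewrite mod0n => /eqP; rewrite -/(dvdn _ _) [(p ^ k.+2)%N]expnSr.
rewrite dvdn_pmul2r ?prime_gt0 // => dv.
by rewrite -(mulr0n 1); apply/(padic_res_natP k _ 0); rewrite mod0n; apply/eqP.
Qed.

Lemma padic_pdvdP x : pdvd p 1 x <-> padic_res x 0 = 0.
Proof.
split=> [[y ->]|x0].
  have -> : y *+ p ^ 1 = y *+ p by rewrite expn1.
  rewrite padic_resMn -mulr_natr.
  have -> : (p%:R : 'Z_(p ^ 1)) = 0%:R.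
    by apply/(padic_res0_natP p 0); rewrite modnn mod0n.
  by rewrite mulr0.
have pa k : (p %| padic_res x k)%N.
  elim: k => [|k IHk]; first by rewrite x0.
  have pk : (p %| p ^ k.+1)%N by rewrite expnS dvdn_mulr.
  by rewrite /dvdn -(modn_dvdm _ pk) padic_res_cong modn_dvdm.
pose y k : 'Z_(p ^ k.+1) := (padic_res x k.+1 %/ p)%N%:R.
have yP k : (y k.+1 : nat)%:R = y k :> 'Z_(p ^ k.+1).
  rewrite /y (padic_val_nat p_pr) (padic_redE p_pr); apply/(padic_res_natP k).
  have divp a b : a = b %[mod p ^ k.+2] -> (p %| a)%N -> (p %| b)%N ->
      a %/ p = b %/ p %[mod p ^ k.+1].
    move=> eab pa_ pb_; apply/eqP; rewrite -(eqn_pmul2r (prime_gt0 p_pr)).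
    by rewrite !muln_modl -expnSr !divnK // eab.
  exact: divp (padic_res_cong x k.+1) (pa _) (pa _).
exists (PadicInt p_pr yP); apply: padic_inj => k.
rewrite [X in _ *+ X]expn1 padic_resMn /= /y -mulrnA divnK //.
by rewrite padic_resP.
Qed.

Lemma padic_prime_elt : prime_elt Zp p.
Proof.
split; first exact: padic_reg.
move=> x y /padic_pdvdP /=.
have res0 (z : Zp) : (p %| padic_res z 0)%N -> pdvd p 1 z.
  move=> dz; apply/padic_pdvdP; rewrite -[LHS]natr_Zp -(mulr0n 1).
  by apply/(padic_res0_natP _ 0); rewrite mod0n; apply/eqP.
rewrite -[padic_res x 0]natr_Zp -[padic_res y 0]natr_Zp -natrM -(mulr0n 1).
move=> /(padic_res0_natP _ 0); rewrite mod0n => /eqP.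
rewrite -/(dvdn _ _) Euclid_dvdM // => /orP[] /res0; [by left|by right].
Qed.

Lemma padic_fermat x : pdvd p 1 (x ^+ p - x).
Proof.
apply/padic_pdvdP; have -> : padic_res (x ^+ p - x) 0 = padic_res x 0 ^+ p - padic_res x 0.
  by rewrite -padic_resX.
apply/eqP; rewrite subr_eq0; apply/eqP.
rewrite -[padic_res x 0]natr_Zp -natrX; apply/padic_res0_natP.
exact: fermat_little.
Qed.

End PadicDivisibility.

(** * Laurent polynomials *)

(* Naming the monomials fixes their canonical structures, which are otherwise
   inferred along different paths and make rewriting fail or diverge. *)
Definition lmono (k : nat) (R : comNzRingType) (c : R) (a : 'rV[int]_k) : laurent k R :=
  << c *g a >>.

Section LaurentTheory.
Variables (k : nat) (R : comNzRingType).
Local Notation L := (laurent k R).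
Implicit Types F G : L.

Lemma mcoeff_lmono (c : R) (a x : 'rV[int]_k) : (lmono c a)@_x = c *+ (a == x).
Proof. exact: mcoeffU. Qed.

Lemma lmono0 (a : 'rV[int]_k) : lmono (0 : R) a = 0.
Proof. exact: monalgU0. Qed.

Lemma lmonoB (c d : R) (a : 'rV[int]_k) : lmono (c - d) a = lmono c a - lmono d a.
Proof. exact: monalgUB. Qed.

Lemma lmonoMn (c : R) (a : 'rV[int]_k) m : lmono (c *+ m) a = lmono c a *+ m.
Proof. exact: monalgUMn. Qed.

Lemma lmonoM (c d : R) (a b : 'rV[int]_k) :
  lmono c a * lmono d b = lmono (c * d) (a + b).
Proof. exact: laurent_mulUU. Qed.

Lemma lmonoX (c : R) (a : 'rV[int]_k) m : lmono c a ^+ m = lmono (c ^+ m) (a *+ m).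
Proof.
elim: m => [|m IHm]; first by rewrite !expr0 mulr0n.
by rewrite !exprS IHm lmonoM mulrS.
Qed.

Lemma laurentE F : F = \sum_(a <- msupp F) lmono F@_a a.
Proof. exact: monalgE. Qed.

Lemma zmod_morphism_sum (U V : zmodType) (f : U -> V) (I : Type) (s : seq I) (x : I -> U) :
  zmod_morphism f -> f (\sum_(i <- s) x i) = \sum_(i <- s) f (x i).
Proof.
move=> fB; have f0 : f 0 = 0 by have := fB 0 0; rewrite !subrr.
by apply: big_morph => // u v; rewrite -[v in LHS]opprK -(sub0r v) fB fB f0 sub0r opprK.
Qed.

Lemma eq_zmod_morphism (M : zmodType) (f g : L -> M) F :
  zmod_morphism f -> zmod_morphism g ->
  (forall a, F@_a != 0 -> f (lmono F@_a a) = g (lmono F@_a a)) -> f F = g F.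
Proof.
move=> fB gB fg; rewrite [F]laurentE !zmod_morphism_sum // big_seq [RHS]big_seq.
by apply: eq_bigr => a aF; apply: fg; rewrite mcoeff_neq0.
Qed.

Lemma mcoeff_laurent_mul F G x :
  (F * G)@_x =
  \sum_(a <- msupp F) \sum_(b <- msupp G) F@_a * G@_b *+ (a + b == x)%R.
Proof.
rewrite [F in LHS]laurentE [G in LHS]laurentE mulr_suml raddf_sum.
apply: eq_bigr => a _ /=; rewrite mulr_sumr raddf_sum.
by apply: eq_bigr => b _ /=; rewrite lmonoM mcoeff_lmono.
Qed.

Lemma mcoeff_laurent1 x : (1 : L)@_x = (x == 0)%:R.
Proof. by rewrite mcoeffU eq_sym. Qed.

Lemma mcoeff_laurent_mul_neq0 F G x : (F * G)@_x != 0 ->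
  exists a b, [/\ F@_a != 0, G@_b != 0 & x = a + b].
Proof.
rewrite mcoeff_laurent_mul => /eqP nz; apply: contrapT => h; apply: nz.
rewrite big_seq big1 // => a aF; rewrite big_seq big1 // => b bG.
have [abx|] := eqVneq; last by rewrite mulr0n.
by case: h; exists a, b; rewrite !mcoeff_neq0.
Qed.

Lemma laurent_pdvdP p s F : pdvd p s F <-> (forall a, pdvd p s F@_a).
Proof.
split=> [[G ->] a|dF]; first by exists G@_a; rewrite mcoeffMn.
exists (\sum_(a <- msupp F) lmono (sval (cid (dF a))) a).
rewrite [LHS]laurentE -sumrMnl; apply: eq_bigr => a _.
by case: (cid (dF a)) => c /= {1}->; rewrite lmonoMn.
Qed.

End LaurentTheory.

Lemma exists_argmax (T : eqType) (f : T -> int) (s : seq T) : s != [::] ->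
  exists2 x, x \in s & forall y, y \in s -> f y <= f x.
Proof.
elim: s => // x s IHs _; have [->|/IHs[y ys ymax]] := eqVneq s [::].
  by exists x; rewrite ?inE // => y; rewrite inE => /eqP ->.
have [fxy|fyx] := leP (f x) (f y).
  exists y; first by rewrite inE ys orbT.
  by move=> z; rewrite inE => /predU1P[->//|/ymax].
exists x; first by rewrite inE eqxx.
move=> z; rewrite inE => /predU1P[->//|/ymax zy].
by apply: le_trans zy (ltW fyx).
Qed.

Lemma int_add_eq (x y a b : int) :
  x <= a -> y <= b -> x + y = a + b -> x = a /\ y = b.
Proof. by lia. Qed.

(* Take the lexicographically largest elements of [A] and [B]. *)
Lemma exists_unique_sum k (A B : seq 'rV[int]_k) : A != [::] -> B != [::] ->
  exists a b, [/\ a \in A, b \in B &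
    forall a' b', a' \in A -> b' \in B -> a' + b' = a + b -> a' = a /\ b' = b].
Proof.
move=> A0 B0.
suff [a [b [aA bB ab]]] : exists a b, [/\ a \in A, b \in B &
    forall a' b', a' \in A -> b' \in B -> a' + b' = a + b ->
      forall i : 'I_k, (i < k)%N -> a' 0 i = a 0 i /\ b' 0 i = b 0 i].
  exists a, b; split=> // a' b' a'A b'B /(ab _ _ a'A b'B) e.
  by split; apply/rowP => i; case: (e i (ltn_ord i)).
suff: forall m, (m <= k)%N -> exists A' B' : seq 'rV[int]_k, [/\
    (A' != [::]) && (B' != [::]), {subset A' <= A}, {subset B' <= B},
    forall a b a' b', a \in A' -> b \in B' -> a' \in A -> b' \in B ->
      a' + b' = a + b -> a' \in A' /\ b' \in B' &
    forall i : 'I_k, (i < m)%N ->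
      (forall a a', a \in A' -> a' \in A' -> a' 0 i = a 0 i) /\
      (forall b b', b \in B' -> b' \in B' -> b' 0 i = b 0 i)].
  move=> /(_ k (leqnn k))[A' [B' [/andP[A'0 B'0] sA sB cl eqi]]].
  case: A' B' A'0 B'0 sA sB cl eqi => // a A' [//|b B'] _ _ sA sB cl eqi.
  have aA' : a \in a :: A' by rewrite inE eqxx.
  have bB' : b \in b :: B' by rewrite inE eqxx.
  exists a, b; split; [exact: sA|exact: sB|].
  move=> a' b' a'A b'B e i /eqi[ea eb].
  have [a'A' b'B'] := cl _ _ _ _ aA' bB' a'A b'B e.
  by split; [apply: ea|apply: eb].
elim=> [_|m IHm mk].
  by exists A, B; split; rewrite ?A0.
have [A' [B' [/andP[A'0 B'0] sA sB cl eqi]]] := IHm (ltnW mk).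
pose j := Ordinal mk.
have [/= a aA' amax] := exists_argmax (fun x : 'rV[int]_k => x 0 j) A'0.
have [b bB' bmax] := exists_argmax (fun x : 'rV[int]_k => x 0 j) B'0.
exists [seq x : 'rV[int]_k <- A' | x 0 j == a 0 j].
exists [seq x : 'rV[int]_k <- B' | x 0 j == b 0 j]; split.
- have aA'' : a \in [seq x : 'rV[int]_k <- A' | x 0 j == a 0 j] by rewrite mem_filter eqxx.
  have bB'' : b \in [seq x : 'rV[int]_k <- B' | x 0 j == b 0 j] by rewrite mem_filter eqxx.
  by move: aA'' bB''; case: filter => // ? ?; case: filter.
- by move=> x; rewrite mem_filter => /andP[_ /sA].
- by move=> x; rewrite mem_filter => /andP[_ /sB].
- move=> x y x' y'; rewrite !mem_filter => /andP[/eqP xj xA] /andP[/eqP yj yB] x'A y'B e.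
  have [x'A' y'B'] := cl _ _ _ _ xA yB x'A y'B e.
  have := congr1 (fun z : 'rV[int]_k => z 0 j) e; rewrite !mxE xj yj.
  move=> /(int_add_eq (amax _ x'A') (bmax _ y'B'))[-> ->].
  by rewrite !eqxx.
- move=> i; rewrite ltnS leq_eqVlt => /predU1P[im|/eqi[ea eb]].
    have -> : i = j by apply: val_inj.
    by split=> u v; rewrite !mem_filter => /andP[/eqP -> _] /andP[/eqP -> _].
  by split=> u v; rewrite !mem_filter => /andP[_ uA] /andP[_ vA]; [apply: ea|apply: eb].
Qed.

Lemma laurent_prime_elt k (R : comNzRingType) p :
  prime_elt R p -> prime_elt (laurent k R) p.
Proof.
move=> [p_reg p_div]; split=> [F Fp0|F G dFG].
  apply/malgP => a; rewrite mcoeff0; apply: p_reg.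
  by rewrite -mcoeffMn Fp0 mcoeff0.
apply: contrapT => /not_orP[nF nG].
pose bad (H : laurent k R) := [seq a <- msupp H | ~~ `[< pdvd p 1 H@_a >]].
have badP H a : ~ pdvd p 1 H@_a -> a \in bad H.
  move=> nHa; rewrite mem_filter; apply/andP; split; first exact/asboolPn.
  by rewrite -mcoeff_neq0; apply: contra_notN nHa => /eqP ->; apply: pdvd0.
have bad_neq0 H : ~ pdvd p 1 H -> bad H != [::].
  move=> nH; have [a nHa] : exists a, ~ pdvd p 1 H@_a.
    by apply/existsNP => dH; apply: nH; apply/laurent_pdvdP.
  by have := badP _ _ nHa; case: (bad H).
have [a [b [aF bG uab]]] := exists_unique_sum (bad_neq0 _ nF) (bad_neq0 _ nG).
have nbad H x : x \in bad H -> ~ pdvd p 1 H@_x.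
  by rewrite mem_filter => /andP[/asboolPn].
case: (p_div F@_a G@_b); [|exact: nbad|exact: nbad].
have /laurent_pdvdP/(_ (a + b)) := dFG; rewrite mcoeff_laurent_mul.
have aS : a \in msupp F by move: aF; rewrite mem_filter => /andP[].
have bS : b \in msupp G by move: bG; rewrite mem_filter => /andP[].
rewrite (bigD1_seq a) ?fset_uniq //= (bigD1_seq b) ?fset_uniq //= eqxx mulr1n -addrA.
set S := (X in _ + X) => dS; rewrite -[F@_a * _](addrK S); apply: pdvdB => //.
have small a' b' : (a', b') != (a, b) ->
    pdvd p 1 (F@_a' * G@_b' *+ (a' + b' == a + b)).
  move=> neq; have [e|] := eqVneq (a' + b') (a + b); last by move=> _; apply: pdvd0.
  rewrite mulr1n; have [/badP a'F|] := pselect (~ pdvd p 1 F@_a'); last first.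
    by move/contrapT; apply: pdvd_mulr.
  have [/badP b'G|] := pselect (~ pdvd p 1 G@_b'); last first.
    by move/contrapT; apply: pdvd_mull.
  by have [ea eb] := uab _ _ a'F b'G e; rewrite ea eb eqxx in neq.
apply: pdvdD; first apply: pdvd_sum => b' _ nb.
  by apply: small; rewrite xpair_eqE negb_and nb orbT.
apply: pdvd_sum => a' _ na; apply: pdvd_sum => b' _ _; apply: small.
by rewrite xpair_eqE negb_and na.
Qed.

Lemma rV_mulrnI k q (a b : 'rV[int]_k) : (0 < q)%N -> (a *+ q == b *+ q) = (a == b).
Proof.
move=> q0; apply/eqP/eqP => [/rowP e|-> //]; apply/rowP => i; have := e i.
by rewrite !mulmxnE => /eqP; rewrite eqrMn2r gtn_eqF //= => /eqP.
Qed.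

Definition laurent_frob (p k : nat) (R : comNzRingType) (phi : R -> R)
    (F : laurent k R) : laurent k R :=
  \sum_(a <- msupp F) lmono (phi F@_a) (a *+ p).

Section LaurentFrobenius.
Variables (p k : nat) (R : comNzRingType) (phi : {rmorphism R -> R}).
Local Notation L := (laurent k R).
Local Notation frob := (@laurent_frob p k R phi).
Implicit Types F G : L.

Lemma laurent_frobw (A : {fset 'rV[int]_k}) F : (msupp F `<=` A)%fset ->
  frob F = \sum_(a <- A) lmono (phi F@_a) (a *+ p).
Proof.
move=> FA; apply: big_fset_incl => // a _ /mcoeff_outdom ->.
by rewrite rmorph0 lmono0.
Qed.

Lemma laurent_frob_zmod_morphism : zmod_morphism frob.
Proof.
move=> F G.
have sB : (msupp (F - G) `<=` msupp F `|` msupp G)%fset.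
  by rewrite -(msuppN G); apply: msuppD_le.
rewrite (laurent_frobw sB) (laurent_frobw (fsubsetUl _ (msupp G))).
rewrite (laurent_frobw (fsubsetUr (msupp F) _)) -sumrB.
by apply: eq_bigr => a _; rewrite mcoeffB rmorphB lmonoB.
Qed.

HB.instance Definition _ :=
  GRing.isZmodMorphism.Build L L frob laurent_frob_zmod_morphism.

Lemma laurent_frobU (c : R) (a : 'rV[int]_k) : frob (lmono c a) = lmono (phi c) (a *+ p).
Proof. by rewrite (laurent_frobw msuppU_le) big_seq_fset1 mcoeff_lmono eqxx. Qed.

Lemma laurent_frob_monoid_morphism : monoid_morphism frob.
Proof.
split=> [|F G]; first by rewrite [LHS]laurent_frobU rmorph1 mul0rn.
apply: (eq_zmod_morphism (f := fun F => frob (F * G)) (g := fun F => frob F * frob G)).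
- by move=> A B; rewrite mulrBl laurent_frob_zmod_morphism.
- by move=> A B; rewrite laurent_frob_zmod_morphism mulrBl.
move=> a _.
apply: (eq_zmod_morphism (f := fun G => frob (lmono F@_a a * G))
  (g := fun G => frob (lmono F@_a a) * frob G)).
- by move=> A B; rewrite mulrBr laurent_frob_zmod_morphism.
- by move=> A B; rewrite laurent_frob_zmod_morphism mulrBr.
move=> b _; transitivity (lmono (phi F@_a) (a *+ p) * lmono (phi G@_b) (b *+ p)).
  by rewrite lmonoM laurent_frobU [RHS]lmonoM rmorphM mulrnDl.
by congr (_ * _); rewrite laurent_frobU.
Qed.

HB.instance Definition _ :=
  GRing.isMonoidMorphism.Build L L frob laurent_frob_monoid_morphism.

Lemma mcoeff_laurent_frob F x : (0 < p)%N -> (frob F)@_(x *+ p) = phi F@_x.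
Proof.
move=> p0; rewrite raddf_sum /=.
have [xF|nx] := boolP (x \in msupp F); last first.
  rewrite mcoeff_outdom // rmorph0 big_seq big1 // => a aF; rewrite mcoeff_lmono rV_mulrnI //.
  by case: eqVneq nx aF => // -> /negP.
rewrite (bigD1_seq x) ?fset_uniq //= [X in X + _]mcoeff_lmono eqxx mulr1n.
rewrite big1 ?addr0 // => a /negPf na.
by rewrite mcoeff_lmono rV_mulrnI // na.
Qed.

Lemma mcoeff_laurent_frob_neq0 F x : (frob F)@_x != 0 ->
  exists2 a, F@_a != 0 & x = a *+ p.
Proof.
rewrite raddf_sum /= => /eqP nz; apply: contrapT => h; apply: nz.
rewrite big_seq big1 // => a aF; rewrite mcoeff_lmono.
have [e|] := eqVneq; last by rewrite mulr0n.
by case: h; exists a; rewrite // mcoeff_neq0.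
Qed.

Lemma laurent_frob_cong F : prime p ->
  (forall c, pdvd p 1 (c ^+ p - phi c)) -> pdvd p 1 (F ^+ p - frob F).
Proof.
move=> p_pr phiP; rewrite [F in F ^+ p]laurentE.
apply: pdvd_trans (pdvd_exp_sum _ _ p_pr) _.
rewrite -sumrB; apply: pdvd_sum => a _ _; rewrite lmonoX -lmonoB.
have [c ->] := phiP F@_a; exists (lmono c (a *+ p)).
by rewrite lmonoMn.
Qed.

Lemma laurent_frob_iterU m (c : R) (a : 'rV[int]_k) :
  iter m frob (lmono c a) = lmono (iter m phi c) (a *+ p ^ m).
Proof.
elim: m => [|m IHm]; first by rewrite expn0 mulr1n.
by rewrite !iterS IHm [LHS]laurent_frobU -mulrnA expnSr.
Qed.

Lemma mcoeff_laurent_frob_iter_neq0 m F x : (iter m frob F)@_x != 0 ->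
  exists2 a, F@_a != 0 & x = a *+ p ^ m.
Proof.
elim: m x => [|m IHm] x; first by exists x.
rewrite iterS => /mcoeff_laurent_frob_neq0[y /IHm[a nza ->] ->].
by exists a; rewrite // -mulrnA expnSr.
Qed.

Lemma laurent_frob_iter_cong m F : prime p ->
  (forall c, pdvd p 1 (c ^+ p - phi c)) -> pdvd p 1 (F ^+ (p ^ m) - iter m frob F).
Proof.
move=> p_pr phiP; elim: m => [|m IHm]; first by rewrite expr1 subrr; apply: pdvd0.
apply: (pdvd_trans (y := (iter m frob F) ^+ p)); last exact: laurent_frob_cong.
by rewrite expnSr exprM; apply: pdvd_expB1.
Qed.

End LaurentFrobenius.

Section IterMorphism.
Variables (R : pzRingType) (f : {rmorphism R -> R}) (e : nat).

Lemma iter_zmod_morphism : zmod_morphism (iter e f).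
Proof. by elim: e => // n IHn x y; rewrite !iterS IHn rmorphB. Qed.

Lemma iter_monoid_morphism : monoid_morphism (iter e f).
Proof.
by elim: e => // n [IH1 IHM]; split=> [|x y] /=; rewrite ?IH1 ?IHM ?rmorph1 ?rmorphM.
Qed.

HB.instance Definition _ := GRing.isZmodMorphism.Build R R (iter e f) iter_zmod_morphism.
HB.instance Definition _ := GRing.isMonoidMorphism.Build R R (iter e f) iter_monoid_morphism.

End IterMorphism.

Section Sigma.
Variables (p : nat) (p_pr : prime p) (n : nat).
Local Notation Zp := (padic_int p_pr).
Local Notation Lz := (laurent n Zp).
Local Notation sigma := (@sigma p p_pr n).

Fact sigma_zmod_morphism : zmod_morphism sigma.
Proof. exact: (@laurent_frob_zmod_morphism p n Zp idfun). Qed.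

Fact sigma_monoid_morphism : monoid_morphism sigma.
Proof. exact: (@laurent_frob_monoid_morphism p n Zp idfun). Qed.

HB.instance Definition _ := GRing.isZmodMorphism.Build Lz Lz sigma sigma_zmod_morphism.
HB.instance Definition _ := GRing.isMonoidMorphism.Build Lz Lz sigma sigma_monoid_morphism.

Lemma sigma_cong (F : Lz) : pdvd p 1 (F ^+ p - sigma F).
Proof.
apply: (@laurent_frob_cong p n Zp idfun) => // c; exact: padic_fermat.
Qed.

Lemma lcongP s (F G : Lz) : lcong s F G <-> pdvd p s (F - G).
Proof.
rewrite laurent_pdvdP; split=> h a; have [c e] := h a.
  by exists c; rewrite e mulr_natl.
by exists c; rewrite e mulr_natl.
Qed.

Lemma Lz_prime_elt : prime_elt Lz p.
Proof. exact/laurent_prime_elt/padic_prime_elt. Qed.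

Lemma pdvd_sigma_iter s m (F : Lz) : pdvd p s (iter m sigma F) <-> pdvd p s F.
Proof.
split=> [|h]; last by exact: (pdvd_raddf (iter m sigma)).
elim: m => //= m IHm /laurent_pdvdP dF; apply: IHm; apply/laurent_pdvdP => a.
have := dF (a *+ p); rewrite (@mcoeff_laurent_frob p n Zp idfun) //.
exact: prime_gt0.
Qed.

Lemma det_sigma_mx e m (A : 'M[Lz]_m) : \det (sigma_mx e A) = iter e sigma (\det A).
Proof. exact: (det_map_mx (iter e sigma)). Qed.

Lemma sigma_mxM e m1 m2 m3 (A : 'M[Lz]_(m1, m2)) (B : 'M[Lz]_(m2, m3)) :
  sigma_mx e (A *m B) = sigma_mx e A *m sigma_mx e B.
Proof. exact: (map_mxM (iter e sigma)). Qed.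

Lemma sigma_mx1 e m : sigma_mx e (1%:M : 'M[Lz]_m) = 1%:M.
Proof. exact: (map_mx1 (iter e sigma)). Qed.

Lemma sigma_mxB e m1 m2 (A B : 'M[Lz]_(m1, m2)) :
  sigma_mx e (A - B) = sigma_mx e A - sigma_mx e B.
Proof. exact: (map_mxB (iter e sigma)). Qed.

Lemma sigma_mxZ e m1 m2 (c : Lz) (A : 'M[Lz]_(m1, m2)) :
  sigma_mx e (c *: A) = iter e sigma c *: sigma_mx e A.
Proof. exact: (map_mxZ (iter e sigma)). Qed.

Lemma adj_sigma_mx e m (A : 'M[Lz]_m) : \adj (sigma_mx e A) = sigma_mx e (\adj A).
Proof. by rewrite [RHS]/sigma_mx (map_mx_adj (iter e sigma)). Qed.

Lemma sigma_mx_add d e m1 m2 (A : 'M[Lz]_(m1, m2)) :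
  sigma_mx d (sigma_mx e A) = sigma_mx (d + e) A.
Proof. by apply/matrixP => i j; rewrite !mxE iterD. Qed.

Lemma sigma_mx0 m1 m2 (A : 'M[Lz]_(m1, m2)) : sigma_mx 0 A = A.
Proof. by apply/matrixP => i j; rewrite mxE. Qed.

Lemma mdvd_sigma_mx e s m1 m2 (A : 'M[Lz]_(m1, m2)) : mdvd p s A -> mdvd p s (sigma_mx e A).
Proof. by move=> dA i j; rewrite mxE; apply/pdvd_sigma_iter. Qed.

Lemma det_sigma_mx_npdvd m g (M : 'M[Lz]_g) :
  ~ pdvd p 1 (\det M) -> ~ pdvd p 1 (\det (sigma_mx m M)).
Proof. by move=> nM; rewrite det_sigma_mx => /pdvd_sigma_iter. Qed.

Lemma quo_cong_sigma_mx m s g (X Y X' Y' : 'M[Lz]_g) :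
  quo_cong p s X Y X' Y' ->
  quo_cong p s (sigma_mx m X) (sigma_mx m Y) (sigma_mx m X') (sigma_mx m Y').
Proof.
rewrite /quo_cong => /(mdvd_sigma_mx m); congr mdvd; rewrite sigma_mxB.
by congr (_ - _); rewrite sigma_mxZ sigma_mxM adj_sigma_mx det_sigma_mx.
Qed.

End Sigma.

Section TSigma.
Variables (p : nat) (p_pr : prime p) (r n : nat).
Local Notation Lz := (laurent n (padic_int p_pr)).
Local Notation Ltz := (laurent_tz p_pr r n).

Definition tsigma : laurent r Lz -> laurent r Lz := laurent_frob p (@sigma p p_pr n).

HB.instance Definition _ := GRing.RMorphism.on tsigma.

Lemma tsigma_iter_cong m (F : Ltz) : pdvd p 1 (F ^+ (p ^ m) - iter m tsigma F).
Proof. by apply: laurent_frob_iter_cong => // c; apply: sigma_cong. Qed.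

Lemma tsigma_iter_exp_cong a b (F : Ltz) :
  pdvd p b.+1 (F ^+ (p ^ (a + b)) - iter a tsigma (F ^+ (p ^ b))).
Proof.
by rewrite expnD exprM rmorphXn; apply: pdvd_expB; apply: tsigma_iter_cong.
Qed.

End TSigma.

(** * Hasse-Witt matrices *)

Lemma monomial_match k g (D : g.-tuple 'rV[int]_k) q s (u v x t : 'rV[int]_k) :
    (0 < q)%N -> uniq D -> (forall w, u + x = w *+ q -> w \in D) ->
  (x + t *+ q == v *+ (q * s) - u) =
  (\sum_i (x == tnth D i *+ q - u)%R * (t == v *+ s - tnth D i)%R)%N :> nat.
Proof.
move=> q0 uD xD.
have [[i xi]|nx] := pselect (exists i, x = tnth D i *+ q - u).
  rewrite (bigD1 i) //= big1 ?addn0 => [|i' i'i]; last first.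
    rewrite xi; case: eqP => // /addIr /eqP; rewrite rV_mulrnI //.
    by rewrite (inj_eq (tuple_uniqP _ uD)) eq_sym (negPf i'i).
  rewrite xi eqxx mul1n; congr nat_of_bool.
  rewrite addrAC (inj_eq (addIr _)) mulnC mulrnA -mulrnDl rV_mulrnI //.
  by rewrite [RHS]eq_sym subr_eq eq_sym addrC.
rewrite big1 => [|i _]; last by case: eqP => // xi; case: nx; exists i.
case: eqP => // e; case: nx.
have e' : u + x = (v *+ s - t) *+ q.
  rewrite mulrnBl -mulrnA mulnC; apply: (addIr (t *+ q)).
  by rewrite subrK -addrA e addrC subrK.
have /tnthP[i vi] := xD _ e'.
by exists i; rewrite -vi -e' addrAC subrr add0r.
Qed.

(* The support condition says that only the monomials of [F] whose exponents
   are of the form [p ^ a * d - u], with [d] in [D], can contribute. *)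
Lemma mcoeff_mul_frob_iter (p k : nat) (R : comNzRingType) (phi : {rmorphism R -> R})
    g (D : g.-tuple 'rV[int]_k) a b (u v : 'rV[int]_k) (F G : laurent k R) :
    (0 < p)%N -> uniq D ->
    (forall x w, F@_x != 0 -> u + x = w *+ p ^ a -> w \in D) ->
  (F * iter a (laurent_frob p phi) G)@_(v *+ p ^ (a + b) - u) =
  \sum_i F@_(tnth D i *+ p ^ a - u) * iter a phi G@_(v *+ p ^ b - tnth D i).
Proof.
move=> p0 uD xD; set y := v *+ _ - u.
pose z i := tnth D i *+ p ^ a - u; pose w i := v *+ p ^ b - tnth D i.
pose T (H : laurent k R) := iter a (laurent_frob p phi) H.
have TB : zmod_morphism T := iter_zmod_morphism _ _.
apply: (eq_zmod_morphism (f := fun F => (F * T G)@_y)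
    (g := fun F => \sum_i F@_(z i) * iter a phi G@_(w i))).
- by move=> A B; rewrite mulrBl mcoeffB.
- by move=> A B; rewrite -sumrB; apply: eq_bigr => i _; rewrite mcoeffB mulrBl.
move=> x Fx; apply: (eq_zmod_morphism (f := fun G => (lmono F@_x x * T G)@_y)
    (g := fun G => \sum_i (lmono F@_x x)@_(z i) * iter a phi G@_(w i))).
- by move=> A B; rewrite TB mulrBr mcoeffB.
- by move=> A B; rewrite -sumrB; apply: eq_bigr => i _; rewrite mcoeffB rmorphB mulrBr.
move=> t _; rewrite /T laurent_frob_iterU lmonoM mcoeff_lmono.
rewrite /y expnD (monomial_match _ _ _ _ uD) ?expn_gt0 ?p0 //; last first.
  by move=> d; apply: xD.
rewrite -sumrMnr; apply: eq_bigr => i _; rewrite !mcoeff_lmono rmorphMn.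
by rewrite mulrnAl mulrnAr -mulrnA mulnC.
Qed.

Section HasseWittMatrices.
Variables (p : nat) (p_pr : prime p) (r n : nat).
Local Notation Lz := (laurent n (padic_int p_pr)).
Local Notation Ltz := (laurent r Lz).
Local Notation sigma := (@sigma p p_pr n).
Local Notation tsigma := (@tsigma p p_pr r n).

Section Additivity.
Variables (m g1 g2 : nat) (D1 : g1.-tuple 'rV[int]_r) (D2 : g2.-tuple 'rV[int]_r).

Lemma HasseWitt_zmod_morphism :
  zmod_morphism (HasseWitt m D1 D2 : Ltz -> 'M[Lz]_(g1, g2)).
Proof. by move=> F G; apply/matrixP => i j; rewrite !mxE mcoeffB. Qed.

HB.instance Definition _ := GRing.isZmodMorphism.Build Ltz 'M[Lz]_(g1, g2)
  (HasseWitt m D1 D2) HasseWitt_zmod_morphism.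

Lemma HasseWitt_mdvd s (F : Ltz) : pdvd p s F -> mdvd p s (HasseWitt m D1 D2 F).
Proof. by move=> /laurent_pdvdP dF i j; rewrite mxE. Qed.

End Additivity.

Lemma HasseWitt_01 g (D : g.-tuple 'rV[int]_r) : uniq D ->
  HasseWitt 0 D D (1 : Ltz) = 1%:M.
Proof.
move=> uD; apply/matrixP => i j; rewrite !mxE mulr1n mcoeff_laurent1 subr_eq0.
by rewrite (inj_eq (tuple_uniqP _ uD)) eq_sym; case: eqP.
Qed.

Lemma HasseWitt_mul a b g1 g2 g3 (D1 : g1.-tuple 'rV[int]_r)
    (D2 : g2.-tuple 'rV[int]_r) (D3 : g3.-tuple 'rV[int]_r) (F G : Ltz) :
    uniq D2 ->
    (forall u x v, u \in D1 -> F@_x != 0 -> u + x = v *+ p ^ a -> v \in D2) ->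
  HasseWitt (a + b) D1 D3 (F * iter a tsigma G) =
  HasseWitt a D1 D2 F *m sigma_mx a (HasseWitt b D2 D3 G).
Proof.
move=> uD2 suppF; apply/matrixP => i j; rewrite !mxE.
have mulE := @mcoeff_mul_frob_iter p r Lz sigma _ D2 a b (tnth D1 i) (tnth D3 j) F G
  (prime_gt0 p_pr) uD2.
apply: etrans (mulE _) _; last by apply: eq_bigr => k _; rewrite !mxE.
by move=> x w; apply: suppF; apply: mem_tnth.
Qed.

End HasseWittMatrices.

(** * Newton polytopes *)

Section Minkowski.
Variables (R : realType) (r : nat).
Local Open Scope classical_set_scope.
Implicit Types A B : set 'rV[R]_r.

Lemma minkowskiA : associative (@minkowski R r).
Proof.
move=> A B C; apply/seteqP; split=> x /=.
  move=> [a Aa [_ [b Bb [c Cc <-]] <-]]; exists (a + b); last by exists c; rewrite // addrA.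
  by exists a => //; exists b.
move=> [_ [a Aa [b Bb <-]] [c Cc <-]]; exists a => //.
by exists (b + c); [exists b => //; exists c|rewrite addrA].
Qed.

Lemma minkowski0l : left_id [set 0] (@minkowski R r).
Proof.
move=> A; apply/seteqP; split=> x /=; first by move=> [_ -> [a Aa <-]]; rewrite add0r.
by move=> Ax; exists 0 => //; exists x; rewrite // add0r.
Qed.

Lemma minkowski0r : right_id [set 0] (@minkowski R r).
Proof.
move=> A; apply/seteqP; split=> x /=; first by move=> [a Aa [_ -> <-]]; rewrite addr0.
by move=> Ax; exists x => //; exists 0; rewrite // addr0.
Qed.

HB.instance Definition _ := Monoid.isLaw.Build (set 'rV[R]_r) [set 0] (@minkowski R r)
  minkowskiA minkowski0l minkowski0r.

Lemma dilate_dilate c d A : dilate c (dilate d A) = dilate (c * d) A.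
Proof.
apply/seteqP; split=> x /=.
  by move=> [_ [a Aa <-] <-]; exists a; rewrite // scalerA natrM.
by move=> [a Aa <-]; exists (d%:R *: a); [exists a|rewrite scalerA natrM].
Qed.

Lemma convex_hull_convex A : convex_set (convex_hull A).
Proof.
move=> x y t /set_mem hx /set_mem hy; apply/mem_set => B [cB AB].
by apply/set_mem/cB; apply/mem_set; [apply: hx|apply: hy].
Qed.

Lemma convex_set_addn A (x y : 'rV[R]_r) m :
  convex_set A -> A x -> dilate m.+1 A y -> dilate m.+2 A (x + y).
Proof.
move=> cA Ax [a Aa <-].
have m0 : (m.+2%:R : R) != 0 by rewrite pnatr_eq0.
have t0 : 0 <= (m.+2%:R^-1 : R) by rewrite invr_ge0.
have t1 : (m.+2%:R^-1 : R) <= 1 by rewrite invf_le1 ?ltr0n // ler1n.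
exists (m.+2%:R^-1 *: x + (1 - m.+2%:R^-1) *: a).
  by have /set_mem := cA x a (Itv01 t0 t1) (mem_set Ax) (mem_set Aa).
rewrite scalerDr !scalerA mulfV // scale1r mulrBr mulr1 mulfV //.
by rewrite [m.+2%:R]mulrSr addrK.
Qed.

End Minkowski.

Section Support.
Variables (R : realType) (r : nat) (K : comNzRingType).
Local Open Scope classical_set_scope.
Implicit Types (S T : set 'rV[R]_r) (F G : laurent r K).

Definition supp_in S F : Prop := forall u, F@_u != 0 -> S (map_mx intr u).

Lemma supp_inB S F G : supp_in S F -> supp_in S G -> supp_in S (F - G).
Proof.
move=> SF SG u; rewrite mcoeffB; have [->|/SF //] := eqVneq F@_u 0.
by rewrite sub0r oppr_eq0; apply: SG.
Qed.

Lemma supp_in_sum S (I : eqType) (s : seq I) (F : I -> laurent r K) :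
  (forall i, i \in s -> supp_in S (F i)) -> supp_in S (\sum_(i <- s) F i).
Proof.
move=> SF; rewrite big_seq; apply: (big_ind (supp_in S)) => //.
  by move=> u; rewrite mcoeff0 eqxx.
move=> F1 F2 S1 S2 u; rewrite mcoeffD; have [->|/S1 //] := eqVneq F1@_u 0.
by rewrite add0r; apply: S2.
Qed.

Lemma supp_in1 : supp_in [set 0] 1.
Proof.
move=> u; rewrite mcoeff_laurent1 /=; case: (eqVneq u 0) => [-> _|_]; last by rewrite eqxx.
by apply/rowP => i; rewrite !mxE.
Qed.

Lemma supp_inM S T F G : supp_in S F -> supp_in T G -> supp_in (minkowski S T) (F * G).
Proof.
move=> SF TG u /mcoeff_laurent_mul_neq0[a [b [/SF Sa /TG Tb ->]]].
exists (map_mx intr a) => //; exists (map_mx intr b) => //.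
by rewrite -map_mxD.
Qed.

Lemma supp_in_prod (s : seq nat) (S : nat -> set 'rV[R]_r) (F : nat -> laurent r K) :
  (forall i, i \in s -> supp_in (S i) (F i)) ->
  supp_in (\big[@minkowski R r/[set 0]]_(i <- s) S i) (\prod_(i <- s) F i).
Proof.
move=> SF; rewrite big_seq [X in supp_in _ X]big_seq.
by elim/big_ind2: _; [exact: supp_in1|move=> *; exact: supp_inM|].
Qed.

Lemma supp_in_exp S F m : convex_set S -> supp_in S F -> supp_in (dilate m.+1 S) (F ^+ m.+1).
Proof.
move=> cS SF; elim: m => [|m IHm].
  by rewrite expr1 => u /SF Su; exists (map_mx intr u); rewrite ?scale1r.
rewrite exprS => u /mcoeff_laurent_mul_neq0[a [b [/SF Sa /IHm Sb ->]]].
by rewrite map_mxD; apply: convex_set_addn.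
Qed.

End Support.

Lemma supp_in_frob_iter (R : realType) r (K : comNzRingType) p (phi : {rmorphism K -> K}) m
    (S : set 'rV[R]_r) (F : laurent r K) :
  supp_in S F -> supp_in (dilate (p ^ m) S) (iter m (laurent_frob p phi) F).
Proof.
move=> SF u /mcoeff_laurent_frob_iter_neq0[a /SF Sa ->].
by exists (map_mx intr a) => //; rewrite raddfMn scaler_nat.
Qed.

Lemma supp_in_newton (R : realType) p (p_pr : prime p) r n (F : laurent_tz p_pr r n) :
  supp_in (newton F : set 'rV[R]_r) F.
Proof. by move=> u Fu; apply: sub_gen_smallest; exists u. Qed.

(** * Ghosts *)

Section Epart.
Variable e : nat -> nat.

Lemma epartnn i : epart e i i = 0%N.
Proof. by rewrite /epart big_geq. Qed.

Lemma epartS i : epart e i i.+1 = e i.+1.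
Proof. by rewrite /epart big_nat1. Qed.

Lemma epartD i j k : (i <= j <= k)%N -> epart e i k = (epart e i j + epart e j k)%N.
Proof. by move=> /andP[ij jk]; rewrite /epart -big_cat_nat. Qed.

Lemma leq_epart l i k : (forall j, (1 <= j <= l.+1)%N -> (0 < e j)%N) ->
  (k <= l.+1)%N -> (k - i <= epart e i k)%N.
Proof.
move=> e0 kl; rewrite -subSS -[X in (X <= _)%N]muln1 -sum_nat_const_nat.
rewrite /epart big_nat [X in (_ <= X)%N]big_nat.
by apply: leq_sum => j /andP[ij jk]; apply: e0; lia.
Qed.

End Epart.

Section Ghost.
Variables (A : comNzRingType) (tau : {rmorphism A -> A}) (p : nat) (e : nat -> nat).
Variable L : nat -> A.

Definition prod_pow i s : A := \prod_(i <= k < s.+1) L k ^+ (p ^ epart e i k).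

Definition ghost_tail i j s : A := iter (epart e i j.+1) tau (prod_pow j.+1 s).

Definition ghost_step i (V : nat -> A) s : A :=
  prod_pow i s - \sum_(i <= j < s) V j * ghost_tail i j s.

(* Iterating [s.+1] times computes the course-of-values recursion [ghostE]. *)
Definition ghost i s : A := iter s.+1 (ghost_step i) (fun=> 0) s.

Lemma ghostE i s : ghost i s = ghost_step i (ghost i) s.
Proof.
suff stab m m' t : (t < m)%N -> (t < m')%N ->
    iter m (ghost_step i) (fun=> 0) t = iter m' (ghost_step i) (fun=> 0) t.
  rewrite /ghost iterS /ghost_step; congr (_ - _).
  by apply: eq_big_nat => j /andP[_ js]; rewrite (stab _ j.+1).
elim: m m' t => // m IHm [//|m'] t; rewrite !ltnS => tm tm'.
rewrite !iterS /ghost_step; congr (_ - _).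
apply: eq_big_nat => j /andP[_ jt].
by rewrite (IHm m') //; [apply: leq_trans jt _|apply: leq_trans jt _].
Qed.

Lemma prod_powE i s :
  prod_pow i s = \sum_(i <= j < s) ghost i j * ghost_tail i j s + ghost i s.
Proof. by rewrite [ghost i s]ghostE /ghost_step addrC subrK. Qed.

Lemma ghostnn i : ghost i i = L i.
Proof.
by rewrite ghostE /ghost_step big_geq // subr0 /prod_pow big_nat1 epartnn expn0 expr1.
Qed.

Lemma ghost_pdvd l i s : (forall j, (1 <= j <= l.+1)%N -> (0 < e j)%N) ->
    (forall a b x, pdvd p b.+1 (x ^+ (p ^ (a + b)) - iter a tau (x ^+ (p ^ b)))) ->
  (i <= s <= l)%N -> pdvd p (s - i) (ghost i s).
Proof.
move=> e0 tauP; elim/ltn_ind: s => s IHs /andP[i_s sl].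
case: s IHs i_s sl => [|s] IHs i_s sl; first exact: pdvd_exp0.
have [->|i_ns] := eqVneq i s.+1; first by rewrite subnn; apply: pdvd_exp0.
have {i_ns} i_s' : (i <= s)%N by lia.
rewrite ghostE /ghost_step; pose x := L s.+1.
have prodS j : (j <= s.+1)%N -> prod_pow j s.+1 = prod_pow j s * x ^+ (p ^ epart e j s.+1).
  by move=> js; rewrite /prod_pow big_nat_recr.
have tailS j : (j <= s)%N -> ghost_tail i j s.+1 =
    ghost_tail i j s * iter (epart e i j.+1) tau (x ^+ (p ^ epart e j.+1 s.+1)).
  by move=> js; rewrite /ghost_tail prodS // rmorphM.
rewrite prodS //; have -> : prod_pow i s = \sum_(i <= j < s.+1) ghost i j * ghost_tail i j s.
  rewrite big_nat_recr //= {1}prod_powE /ghost_tail.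
  by rewrite [prod_pow s.+1 s]big_geq // rmorph1 mulr1.
rewrite mulr_suml -sumrB; apply: pdvd_sum => j.
rewrite mem_index_iota => /andP[ij js] _.
rewrite tailS // mulrA -mulrBr.
rewrite (@epartD e i j.+1 s.+1); last by lia.
have -> : (s.+1 - i = (j - i) + (s - j).+1)%N by lia.
apply: pdvdM; first by apply: pdvd_mulr; apply: IHs => //; lia.
apply: pdvdW (tauP _ _ _); rewrite ltnS.
by have := @leq_epart e l j.+1 s.+1 e0; lia.
Qed.

End Ghost.

(** * Dwork congruences *)

Section Sequences.
Variables (R : realType) (p : nat) (p_pr : prime p) (r n g l : nat) (e : nat -> nat).
Hypothesis e_gt0 : forall i, (1 <= i <= l.+1)%N -> (0 < e i)%N.
Variable Delta : nat -> g.-tuple 'rV[int]_r.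
Hypothesis Delta_uniq : forall i, (i <= l.+1)%N -> uniq (Delta i).
Variable Lambda : nat -> laurent_tz p_pr r n.
Hypothesis Lambda_adm : admissible R l e Delta Lambda.
Local Notation Lz := (laurent n (padic_int p_pr)).
Local Notation Ltz := (laurent r Lz).
Local Notation tsigma := (@tsigma p p_pr r n).
Local Notation gh := (@ghost Ltz tsigma p e Lambda).
Local Notation tail := (@ghost_tail Ltz tsigma p e Lambda).
Local Notation prodp := (@prod_pow Ltz p e Lambda).
Local Notation A := (HasseWitt_tuple e Delta Lambda).
Local Notation H i := (HasseWitt (e i.+1) (Delta i) (Delta i.+1) (Lambda i)).

Let box i k : set 'rV[R]_r := dilate (p ^ epart e i k) (newton (Lambda k)).

Lemma supp_in_newton_exp k m : supp_in (dilate (p ^ m) (newton (Lambda k) : set 'rV[R]_r))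
  (Lambda k ^+ (p ^ m) : Ltz).
Proof.
rewrite -(@prednK (p ^ m)) ?expn_gt0 ?prime_gt0 //.
by apply: supp_in_exp; [exact: convex_hull_convex|exact: supp_in_newton].
Qed.

Lemma supp_in_prod_pow i s :
  supp_in (\big[@minkowski R r/[set 0]%classic]_(i <= k < s.+1) box i k) (prodp i s).
Proof. by apply: supp_in_prod => k _; apply: supp_in_newton_exp. Qed.

Lemma supp_in_ghost_tail i j s : (i <= j)%N ->
  supp_in (\big[@minkowski R r/[set 0]%classic]_(j.+1 <= k < s.+1) box i k) (tail i j s).
Proof.
move=> ij; rewrite /ghost_tail rmorph_prod; apply: supp_in_prod => k.
rewrite mem_index_iota => /andP[jk _].
rewrite /box (@epartD e i j.+1 k) ?jk ?(leqW ij) // expnD -dilate_dilate.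
by apply: supp_in_frob_iter; apply: supp_in_newton_exp.
Qed.

Lemma supp_in_ghost i s :
  supp_in (\big[@minkowski R r/[set 0]%classic]_(i <= k < s.+1) box i k) (gh i s).
Proof.
elim/ltn_ind: s => s IHs; rewrite ghostE; apply: supp_inB; first exact: supp_in_prod_pow.
apply: supp_in_sum => j; rewrite mem_index_iota => /andP[ij js].
rewrite (big_cat_nat (n := j.+1)) /=; [|exact: leqW|exact: leqW].
by apply: supp_inM; [exact: IHs|exact: supp_in_ghost_tail].
Qed.

Lemma admissible_ghost i j (u x v : 'rV[int]_r) : (i <= j < l)%N ->
  u \in Delta i -> (gh i j)@_x != 0 -> u + x = v *+ p ^ epart e i j.+1 ->
  v \in Delta j.+1.
Proof.
move=> ijl uD /(@supp_in_ghost i j) xs uxv.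
have [|_ [w wD <-] we] := Lambda_adm ijl (t := map_mx intr (u + x)).
  split; last first.
    exists (map_mx intr v); first by exists v.
    by rewrite uxv raddfMn scaler_nat.
  exists (map_mx intr u); first by exists u.
  by exists (map_mx intr x) => //; rewrite -map_mxD.
suff -> : v = w by [].
apply/eqP; rewrite eq_sym -(@rV_mulrnI r (p ^ epart e i j.+1)) ?expn_gt0 ?prime_gt0 //.
have /matrixP wv : map_mx intr (w *+ p ^ epart e i j.+1) =
    map_mx intr (v *+ p ^ epart e i j.+1) :> 'rV[R]_r.
  by rewrite -uxv -we raddfMn scaler_nat.
apply/eqP/matrixP => a b; have := wv a b.
by rewrite mxE [X in _ = X]mxE => /eqP; rewrite eqr_int => /eqP.
Qed.

Let B i j : 'M[Lz]_g := HasseWitt (epart e i j.+1) (Delta i) (Delta j.+1) (gh i j : Ltz).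

Lemma HasseWitt_ghost_mdvd i j : (i <= j <= l)%N -> mdvd p (j - i) (B i j).
Proof.
move=> ijl; apply: HasseWitt_mdvd; apply: ghost_pdvd ijl => //.
by move=> a b x; apply: tsigma_iter_exp_cong.
Qed.

Lemma HasseWitt_ghostnn i : B i i = H i.
Proof. by rewrite /B ghostnn epartS. Qed.

Lemma HasseWitt_tupleE i s : (i <= s <= l)%N ->
  A i s = \sum_(i <= j < s) B i j *m sigma_mx (epart e i j.+1) (A j.+1 s) + B i s.
Proof.
move=> /andP[i_s sl]; rewrite {1}/HasseWitt_tuple -[\prod_(_ <= _ < _) _]/(prodp i s).
rewrite (prod_powE tsigma) raddfD /=; congr (_ + _).
rewrite (zmod_morphism_sum _ _ (HasseWitt_zmod_morphism _ _ _)).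
apply: eq_big_nat => j /andP[ij js].
rewrite (@epartD e i j.+1 s.+1); last by lia.
apply: HasseWitt_mul; first by apply: Delta_uniq; lia.
by move=> u x v; apply: admissible_ghost; lia.
Qed.

Lemma HasseWitt_tupleSn s : (s <= l)%N -> A s.+1 s = 1%:M.
Proof.
move=> sl; rewrite /HasseWitt_tuple epartnn big_geq //.
by apply: HasseWitt_01; apply: Delta_uniq.
Qed.

Lemma HasseWitt_tuple_mod_p i s : (i <= s <= l)%N ->
  mdvd p 1 (A i s - H i *m sigma_mx (e i.+1) (A i.+1 s)).
Proof.
move=> /andP[]; rewrite leq_eqVlt => /predU1P[<- il|i_s sl].
  rewrite HasseWitt_tupleE ?leqnn // big_geq // add0r HasseWitt_ghostnn.
  by rewrite HasseWitt_tupleSn // sigma_mx1 mulmx1 subrr; apply: mdvd0.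
rewrite HasseWitt_tupleE ?(ltnW i_s) // big_ltn // HasseWitt_ghostnn epartS.
rewrite addrC !addrA addNr add0r; apply: mdvdD.
  apply: mdvd_sum => j; rewrite mem_index_iota => /andP[ij js].
  apply: mdvd_mulr; apply: mdvdW (HasseWitt_ghost_mdvd _); lia.
by apply: mdvdW (HasseWitt_ghost_mdvd _); lia.
Qed.

Lemma HasseWitt_tuple_prod i s : (i <= s <= l)%N ->
  mdvd p 1 (A i s - \big[mulmx/1%:M]_(i <= k < s.+1) sigma_mx (epart e i k) (H k)).
Proof.
move=> /andP[i_s sl]; have [m mE] : exists m, s = (i + m)%N by exists (s - i)%N; lia.
elim: m i i_s mE => [|m IHm] i i_s mE.
  have -> : s = i by lia.
  rewrite big_ltn // big_geq // mulmx1 epartnn sigma_mx0.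
  have := @HasseWitt_tuple_mod_p i i; rewrite HasseWitt_tupleSn; last by lia.
  by rewrite sigma_mx1 mulmx1; apply; lia.
apply: mdvd_trans (HasseWitt_tuple_mod_p _) _; first by lia.
rewrite big_ltn; last by lia.
rewrite epartnn sigma_mx0 -mulmxBr; apply: mdvd_mull.
have -> : \big[mulmx/1%:M]_(i.+1 <= k < s.+1) sigma_mx (epart e i k) (H k) =
    sigma_mx (e i.+1) (\big[mulmx/1%:M]_(i.+1 <= k < s.+1) sigma_mx (epart e i.+1 k) (H k)).
  rewrite (big_morph (@sigma_mx p p_pr n (e i.+1) g g)
    (@sigma_mxM p p_pr n (e i.+1) g g g) (sigma_mx1 _ _ _ _)).
  apply: eq_big_nat => k /andP[ik _].
  by rewrite sigma_mx_add (@epartD e i i.+1 k) ?epartS //; lia.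
by rewrite -sigma_mxB; apply: mdvd_sigma_mx; apply: IHm; lia.
Qed.

Section Determinants.
Hypothesis det_neq0 : forall i, (i <= l)%N -> ~ pdvd p 1 (\det (H i)).

Let npdvd1 : ~ pdvd p 1 (1 : Lz).
Proof.
move=> h; apply: (det_neq0 (leq0n l)); rewrite -[\det _]mul1r.
exact: pdvd_mulr.
Qed.

Lemma det_HasseWitt_tuple i s : (i <= s.+1)%N -> (s <= l)%N -> ~ pdvd p 1 (\det (A i s)).
Proof.
move=> i_s sl; have [m mE] : exists m, s.+1 = (i + m)%N by exists (s.+1 - i)%N; lia.
elim: m i i_s mE => [|m IHm] i i_s mE.
  have -> : i = s.+1 by lia.
  by rewrite HasseWitt_tupleSn // det1.
move=> dA; have is' : (i <= s <= l)%N by lia.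
have /pdvd_subC dHA := mdvd_det (HasseWitt_tuple_mod_p is').
have : pdvd p 1 (\det (H i *m sigma_mx (e i.+1) (A i.+1 s))).
  by rewrite -[\det _](subrK (\det (A i s))); apply: pdvdD.
rewrite det_mulmx; apply: npdvdM; [exact: Lz_prime_elt|by apply: det_neq0; lia|].
by apply: det_sigma_mx_npdvd; apply: IHm; lia.
Qed.

Lemma Dwork_congruence i s : (i <= s < l)%N ->
  let X := sigma_mx (e i.+1) (A i.+1 s.+1) in
  let Y := sigma_mx (e i.+1) (A i.+1 s) in
  mdvd p (s.+1 - i) (\det Y *: (A i s.+1 *m \adj X) - \det X *: (A i s *m \adj Y)).
Proof.
move=> /andP[i_s sl]; have [m mE] : exists m, (s - i)%N = m by exists (s - i)%N.
elim/ltn_ind: m i i_s mE => m IHm i i_s mE /=.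
have Lp := @Lz_prime_elt p p_pr n.
pose X j := sigma_mx (epart e i j) (A j s.+1).
pose Y j := sigma_mx (epart e i j) (A j s).
have nY j : (j <= s.+1)%N -> ~ pdvd p 1 (\det (Y j)).
  by move=> js; apply: det_sigma_mx_npdvd; apply: det_HasseWitt_tuple; lia.
have step k : (i < k <= s)%N -> quo_cong p (s.+1 - k) (X k) (Y k) (X k.+1) (Y k.+1).
  move=> iks; have nk : ~ pdvd p 1 (\det (sigma_mx (e k.+1) (A k.+1 s.+1))).
    by apply: det_sigma_mx_npdvd; apply: det_HasseWitt_tuple; lia.
  have kq := quo_cong_of_fraccong Lp nk (IHm (s - k)%N ltac:(lia) k ltac:(lia) erefl).
  have := quo_cong_sigma_mx (epart e i k) kq.
  by rewrite !sigma_mx_add -(epartS e k) -epartD //; lia.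
have chain j : (i <= j <= s)%N ->
    quo_cong p (s.+1 - j) (X i.+1) (Y i.+1) (X j.+1) (Y j.+1).
  elim: j => [|j IHj] /andP[ij js].
    by move: ij; rewrite leqn0 => /eqP ->; apply: quo_cong_refl.
  have [<-|ij'] := eqVneq i j.+1; first exact: quo_cong_refl.
  apply: (quo_cong_trans Lp (nY j.+1 _)); first by lia.
    by apply: mdvdW (IHj _); lia.
  by apply: step; lia.
have frac j : (i <= j <= s)%N -> mdvd p (s.+1 - j)
    (\det (Y i.+1) *: (X j.+1 *m \adj (X i.+1)) - \det (X i.+1) *: (Y j.+1 *m \adj (Y i.+1))).
  move=> ijs; apply: fraccong_of_quo_cong => //; first by apply: nY; lia.
  by apply: quo_cong_sym; apply: chain.
rewrite -(epartS e i) -/(X i.+1) -/(Y i.+1).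
have -> : A i s = \sum_(i <= j < s.+1) B i j *m Y j.+1.
  have YS : Y s.+1 = 1%:M by rewrite /Y (HasseWitt_tupleSn (ltnW sl)) sigma_mx1.
  transitivity (\sum_(i <= j < s) B i j *m Y j.+1 + B i s).
    by apply: HasseWitt_tupleE; rewrite i_s ltnW.
  by rewrite big_nat_recr //; congr (_ + _); rewrite YS mulmx1.
rewrite HasseWitt_tupleE; last by lia.
apply: mdvd_sum_mulB => [j js|j js|]; [|exact: frac|].
  by apply: HasseWitt_ghost_mdvd; lia.
by apply: HasseWitt_ghost_mdvd; lia.
Qed.

End Determinants.
End Sequences.

Theorem theorem2p6 (R : realType) (p : nat) (p_pr : prime p) (p_odd : odd p)
    (r n g l : nat) (g_gt0 : (0 < g)%N)
    (e : nat -> nat) (e_gt0 : forall i : nat, (1 <= i <= l.+1)%N -> (0 < e i)%N)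
    (Delta : nat -> g.-tuple 'rV[int]_r)
    (Delta_uniq : forall i : nat, (i <= l.+1)%N -> uniq (Delta i))
    (Lambda : nat -> laurent_tz p_pr r n)
    (Lambda_adm : admissible R l e Delta Lambda) :
  (forall s : nat, (s <= l)%N ->
     mxcong 1
       (HasseWitt_tuple e Delta Lambda 0 s)
       (\big[mulmx/1%:M]_(0 <= i < s.+1)
          sigma_mx (epart e 0 i)
            (HasseWitt (e i.+1) (Delta i) (Delta i.+1) (Lambda i))))
  /\
  ((forall i : nat, (i <= l)%N ->
      ~ lcong 1 (\det (HasseWitt (e i.+1) (Delta i) (Delta i.+1) (Lambda i))) 0) ->
   forall s : nat, (1 <= s <= l)%N ->
     ~ lcong 1 (\det (HasseWitt_tuple e Delta Lambda 1 s)) 0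
     /\ fraccong s
          (HasseWitt_tuple e Delta Lambda 0 s)
          (sigma_mx (e 1%N) (HasseWitt_tuple e Delta Lambda 1 s))
          (HasseWitt_tuple e Delta Lambda 0 s.-1)
          (if s == 1%N then 1%:M
           else sigma_mx (e 1%N) (HasseWitt_tuple e Delta Lambda 1 s.-1))).
Proof.
have mxcongP s (F G : 'M[laurent n (padic_int p_pr)]_g) : mxcong s F G <-> mdvd p s (F - G).
  by split=> h i j; have := h i j; rewrite lcongP !mxE.
split=> [s sl|det_nz s s1l].
  by apply/mxcongP; apply: (HasseWitt_tuple_prod e_gt0 Delta_uniq Lambda_adm).
have {}det_nz i : (i <= l)%N ->
    ~ pdvd p 1 (\det (HasseWitt (e i.+1) (Delta i) (Delta i.+1) (Lambda i))).
  by move=> il; have := det_nz i il; rewrite lcongP subr0.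
have det_tuple := det_HasseWitt_tuple e_gt0 Delta_uniq Lambda_adm det_nz.
case: s s1l => // s sl.
split; first by rewrite lcongP subr0; apply: det_tuple.
have -> : (if s.+1 == 1%N then 1%:M else sigma_mx (e 1%N) (HasseWitt_tuple e Delta Lambda 1 s)) =
    sigma_mx (e 1%N) (HasseWitt_tuple e Delta Lambda 1 s).
  by case: s sl => // _; rewrite (HasseWitt_tupleSn e Delta_uniq Lambda (leq0n l)) sigma_mx1.
split.
- by rewrite lcongP subr0; apply: det_sigma_mx_npdvd; apply: det_tuple.
- by rewrite lcongP subr0; apply: det_sigma_mx_npdvd; apply: det_tuple => //; apply: ltnW.
by apply/mxcongP; apply: (Dwork_congruence e_gt0 Delta_uniq Lambda_adm det_nz (i := 0)).
Qed.
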